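(* The boundary control system is not spectrally controllable in $H^1_0(0,1)\times L^2(0,1)$: for every $T>0$ and every nonzero $U^0=(u_0,v_0)$ belonging to the linear span of finitely many eigenfunctions of $A$ (i.e. of finitely many elements of $\{U_0\}\cup\{U_n:n\in\mathbb{Z}\setminus\{0\}\}$), there is no $h\in H^1(0,T)$ with $h(0)=0$ such that the solution $(u,v)$ of the boundary control system with initial data $(u_0,v_0)$ and control $h$ satisfies $u(\cdot,T)=0$ and $v(\cdot,T)=0$.
   Context: Complex-valued functions. $\mathcal{H}=H^1_0(0,1)\times L^2(0,1)$ with inner product $((u,v),(\varphi,\psi))_{\mathcal{H}}=\int_0^1(u'\overline{\varphi'}+u\overline\varphi)+\int_0^1v\overline\psi$. $(I-\partial_x^2)^{-1}$: inverse of $I-d^2/dx^2$ on $(0,1)$ with homogeneous Dirichlet conditions ($H^{-1}\to H^1_0$). $A(u,v)=(-(I-\partial_x^2)^{-1}\partial_xv,-\partial_xu)$ on $\mathcal{H}$. Its eigenfunctions: $U_0=(0,1)$ (eigenvalue $0$) and $U_n=(\frac{\sin(n\pi x)}{\sqrt{1+n^2\pi^2}},\,i\cos(n\pi x))$ with eigenvalue $\frac{in\pi}{\sqrt{1+n^2\pi^2}}$, $n\in\mathbb{Z}\setminus\{0\}$. Boundary control system: $\partial_tu-\partial_t\partial_x^2u-\partial_xv=0$, $\partial_tv-\partial_xu=0$ on $(0,1)\times(0,T)$, $u(0,t)=0$, $u(1,t)=h(t)$, $(u,v)(\cdot,0)=(u_0,v_0)$; its solution (for $h\in H^1(0,T)$,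 $u_0(1)=h(0)$) is $u=w+xh(t)$, $v=z$, where $W=(w,z)\in C([0,T];\mathcal{H})$, $W(t)=e^{-tA}W_0+\int_0^te^{-(t-\tau)A}F(\tau)d\tau$, $W_0=(u_0-xh(0),v_0)$, $F(t)=(-(I-\partial_x^2)^{-1}(x h'(t)),h(t))$. *)

(* Defs.v *)
(* Complex numbers are R[i] (mathcomp-real-closed). *)
From HB Require Import structures.
From mathcomp Require Import all_boot all_order all_algebra.
From mathcomp Require Import all_classical all_reals all_analysis.
From mathcomp Require Import complex.
Set Implicit Arguments. Unset Strict Implicit. Unset Printing Implicit Defensive.
Import Order.TTheory GRing.Theory Num.Theory.
Import numFieldNormedType.Exports.
Local Open Scope classical_set_scope.
Local Open Scope ring_scope.

Section Defs.
Variable R : realType.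

Local Notation mu := (@lebesgue_measure R).

(* Lebesgue integral over D of a complex-valued function, real and
   imaginary parts separately. *)
Definition cint (D : set R) (f : R -> R[i]) : R[i] :=
  Complex (\int[mu]_(x in D) complex.Re (f x))
          (\int[mu]_(x in D) complex.Im (f x)).

(* f is (a representative of) an element of L^2(a,b) *)
Definition L2 (a b : R) (f : R -> R[i]) : Prop :=
  measurable_fun `[a, b]%classic (fun x => complex.Re (f x)) /\
  measurable_fun `[a, b]%classic (fun x => complex.Im (f x)) /\
  (\int[mu]_(x in `[a, b]%classic)
      ((complex.Re (f x)) ^+ 2 + (complex.Im (f x)) ^+ 2)%:E < +oo)%E.

(* u is the (absolutely continuous representative of an) H^1(a,b) function
   whose weak derivative is g:  u(x) = u(a) + \int_a^x g, g in L^2(a,b). *)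
Definition is_prim (a b : R) (u g : R -> R[i]) : Prop :=
  L2 a b g /\ forall x, a <= x <= b -> u x = u a + cint `[a, x]%classic g.

(* u in H^1_0(0,1), with weak derivative g *)
Definition H10 (u g : R -> R[i]) : Prop :=
  is_prim 0 1 u g /\ u 0 = 0 /\ u 1 = 0.

(* L^2(0,1) inner product (linear in the first, antilinear in the second) *)
Definition L2ip (f g : R -> R[i]) : R[i] :=
  cint `[0, 1]%classic (fun x => f x * (g x)^*).

(* H^1_0(0,1) inner product  \int u' conj(phi') + u conj(phi) *)
Definition H1ip (u u' p p' : R -> R[i]) : R[i] := L2ip u' p' + L2ip u p.

(* An element (u,v) of H = H^1_0(0,1) x L^2(0,1), carried together with a
   weak derivative du of u. *)
Record Hel := mkHel { Hu : R -> R[i]; Hdu : R -> R[i]; Hv : R -> R[i] }.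

Definition inH (U : Hel) : Prop := H10 (Hu U) (Hdu U) /\ L2 0 1 (Hv U).

(* inner product of H *)
Definition Hip (U V : Hel) : R[i] :=
  H1ip (Hu U) (Hdu U) (Hu V) (Hdu V) + L2ip (Hv U) (Hv V).

Definition Hsub (U V : Hel) : Hel :=
  mkHel (fun x => Hu U x - Hu V x) (fun x => Hdu U x - Hdu V x)
        (fun x => Hv U x - Hv V x).

Definition Hopp (U : Hel) : Hel :=
  mkHel (fun x => - Hu U x) (fun x => - Hdu U x) (fun x => - Hv U x).

(* squared H-norm *)
Definition Hnorm2 (U : Hel) : R := complex.Re (Hip U U).

(* W in C([0,T]; H) *)
Definition Hcont (T : R) (W : R -> Hel) : Prop :=
  forall t, 0 <= t <= T -> forall e, 0 < e -> exists2 d, 0 < d &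
    forall s, 0 <= s <= T -> `|s - t| < d -> Hnorm2 (Hsub (W s) (W t)) < e.

(* psi = (I - d^2/dx^2)^{-1} f  (homogeneous Dirichlet), where f in H^{-1} is
   given through its (antilinear) action  l chi chi' = <f, chi>  on
   chi in H^1_0 with weak derivative chi':  psi in H^1_0 and
   (psi, chi)_{H^1_0} = <f, chi> for all chi in H^1_0. *)
Definition resolvent (l : (R -> R[i]) -> (R -> R[i]) -> R[i])
  (psi psi' : R -> R[i]) : Prop :=
  H10 psi psi' /\
  forall chi chi', H10 chi chi' -> H1ip psi psi' chi chi' = l chi chi'.

(* eigenfunctions of A:  U_0 = (0,1),
   U_n = (sin(n pi x)/sqrt(1+n^2 pi^2), i cos(n pi x)), n <> 0 *)
Definition eigfun (n : int) : Hel :=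
  if n == 0 then mkHel (fun _ => 0) (fun _ => 0) (fun _ => 1)
  else
    let a := n%:~R * pi in
    let c := Num.sqrt (1 + a ^+ 2) in
    mkHel (fun x => (sin (a * x) / c)%:C%C)
          (fun x => (a * cos (a * x) / c)%:C%C)
          (fun x => 'i%C * (cos (a * x))%:C%C).

(* the linear combination  \sum_{n in s} c_n U_n *)
Definition eigcomb (s : seq int) (c : int -> R[i]) : Hel :=
  mkHel (fun x => \sum_(n <- s) c n * Hu (eigfun n) x)
        (fun x => \sum_(n <- s) c n * Hdu (eigfun n) x)
        (fun x => \sum_(n <- s) c n * Hv (eigfun n) x).

(* W : [0,T] -> H is the solution
     W(t) = e^{-tA} W_0 + \int_0^t e^{-(t-tau)A} F(tau) dtau
   with W_0 = (u_0 - x h(0), v_0), F(t) = (-(I-d_x^2)^{-1}(x h'(t)), h(t)),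
   A(w,z) = (-(I-d_x^2)^{-1} d_x z, - d_x w), h' = k.
   Since A is bounded on H, this is the unique W in C([0,T];H) with
     W(t) = W_0 + \int_0^t (- A W(s) + F(s)) ds,
   the H-valued integral being tested against every phi in H.
   Psi s = (I-d_x^2)^{-1} d_x z(s) and Phi s = (I-d_x^2)^{-1}(x k(s)). *)
Definition is_solution (T : R) (U0 : Hel) (h k : R -> R[i]) (W : R -> Hel)
  : Prop :=
  let W0 := mkHel (fun x => Hu U0 x - x%:C%C * h 0) (fun x => Hdu U0 x - h 0)
                  (Hv U0) in
  (forall t, 0 <= t <= T -> inH (W t)) /\ Hcont T W /\
  exists Psi Psi' Phi Phi' : R -> R -> R[i],
    (forall s, 0 <= s <= T ->
       resolvent (fun chi chi' => - L2ip (Hv (W s)) chi') (Psi s) (Psi' s)) /\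
    (forall s, 0 <= s <= T ->
       resolvent (fun chi chi' => L2ip (fun x => x%:C%C * k s) chi)
                 (Phi s) (Phi' s)) /\
    let AW s := mkHel (fun x => - Psi s x) (fun x => - Psi' s x)
                      (fun x => - Hdu (W s) x) in
    let F s := mkHel (fun x => - Phi s x) (fun x => - Phi' s x)
                     (fun _ => h s) in
    forall phi, inH phi -> forall t, 0 <= t <= T ->
      Hip (W t) phi = Hip W0 phi +
        cint `[0, t]%classic (fun s => - Hip (AW s) phi + Hip (F s) phi).

End Defs.

(* Main.v *)
Require Import Defs.
From HB Require Import structures.
From mathcomp Require Import all_boot all_order all_algebra.
From mathcomp Require Import all_classical all_reals all_analysis.
From mathcomp Require Import complex measurable_realfun ring lra.
Import Order.TTheory GRing.Theory Num.Theory.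
Import numFieldNormedType.Exports.
Local Open Scope classical_set_scope.
Local Open Scope ring_scope.
Set Implicit Arguments. Unset Strict Implicit. Unset Printing Implicit Defensive.

(* Write omega_n = n pi / sqrt (1 + n^2 pi^2).  For n <> 0 the mode
   a_n t = (W t, U_n) solves a_n' = - i omega_n a_n - beta_n h' with
   beta_n <> 0.  If the control steers the solution to rest, then h T = 0 and
   the substitution y = a_n + beta_n h leads to
   (U^0, U_n) = - i omega_n beta_n \int_0^T e^(i omega_n s) h s ds.
   The left-hand side vanishes as soon as |n| exceeds every index used in U^0.
   Since omega_n -> 1, the analytic function z |-> \int_0^T e^(i z s) h s ds has
   an accumulation point of zeros, hence is identically 0.  Therefore U^0 is
   orthogonal to every U_n (at n = 0 one reads \int_0^T h = 0), in particular
   to itself. *)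

(** * An identity theorem *)

(** The obstruction is spectral: A is bounded on H, so its eigenvalues i omega_n stay bounded and
    cluster, here at i as n tends to +oo. Since the omega_n are real and different from 1, the
    identity theorem is needed on the real line only, for the real and imaginary parts of the
    transform separately. Complex analyticity is replaced there by a bound M T^m on the m-th
    derivative, which comes from the factor s^m with 0 <= s <= T.

    The substitution y serves two purposes. The derivative h' is merely square integrable, so a_n is
    only absolutely continuous, whereas y has a continuous derivative. Moreover the moments are then
    expressed through h instead of h', so that the same transform, evaluated at z = 0, also
    describes the mode n = 0, whose equation contains h and not h'. Nothing is known about that
    value beforehand; it is reached by the identity theorem.

    No completeness of the U_n enters: U^0 is a finite combination, and expanding one factor of
    (U^0, U^0) suffices. *)

Lemma le_geometric_le0 (R : realType) (x C : R) :
  (forall j : nat, x <= C / 2 ^+ j) -> x <= 0.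
Proof.
move=> xC; rewrite leNgt; apply/negP => x0.
pose j := Num.Def.archi_bound (C / x).
have C0 : 0 <= C by have := xC 0%N; rewrite expr0 divr1; apply/le_trans/ltW.
have Cj : C / x < j%:R by apply: archi_boundP; rewrite divr_ge0// ltW.
have j2 : (j%:R : R) <= 2 ^+ j by rewrite -natrX ler_nat ltnW// ltn_expl.
have := lt_le_trans Cj j2; rewrite ltr_pdivrMr// mulrC -ltr_pdivrMr ?exprn_gt0//.
by rewrite ltNge xC.
Qed.

(** The order of [x] and [y] is left open, and of the position of [c] only its distance to [x] is
    kept: this is what confines [c] to any ball around [x] that contains [y]. *)
Lemma MVT_dist (R : realType) (f df : R -> R) (x y : R) :
  (forall z : R, is_derive z 1 f (df z)) ->
  exists2 c, `|c - x| <= `|y - x| & f y - f x = df c * (y - x).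
Proof.
move=> fdf.
have fc a b : {within `[a, b], continuous f}.
  apply: continuous_subspaceT => z.
  by apply: differentiable_continuous; apply/derivable1_diffP; apply: ex_derive.
have [xy|/ltW yx] := leP x y.
  have [c] := MVT_segment xy (fun z _ => fdf z) (fc x y).
  rewrite in_itv/= => /andP[xc cy] E; exists c => //.
  by rewrite !ger0_norm ?subr_ge0// lerD2r.
have [c] := MVT_segment yx (fun z _ => fdf z) (fc y x).
rewrite in_itv/= => /andP[yc cx] E; exists c => //.
  by rewrite !ler0_norm ?subr_le0// lerN2 lerD2r.
by rewrite -opprB E -mulrN opprB.
Qed.

(* By Rolle's theorem the zeros of every derivative accumulate at [x0], so all
   derivatives vanish there; the geometric bound then lets this property
   propagate by steps of length 1/(2K). *)
Lemma identity_geometric (R : realType) (G : nat -> R -> R) (M K x0 : R) :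
  0 < K ->
  (forall m (z : R), is_derive z 1 (G m) (G m.+1 z)) ->
  (forall m z, `|G m z| <= M * K ^+ m) ->
  (forall e, 0 < e -> exists2 z, 0 < `|z - x0| < e & G 0%N z = 0) ->
  forall z, G 0%N z = 0.
Proof.
move=> K0 dG GM acc.
have cG m : continuous (G m).
  move=> z.
  by apply: differentiable_continuous; apply/derivable1_diffP; apply: ex_derive.
have acc0 m : (forall e, 0 < e -> exists2 z, 0 < `|z - x0| < e & G m z = 0) ->
    G m x0 = 0.
  move=> accm; apply/eqP; rewrite -normr_eq0 eq_le normr_ge0 andbT.
  apply/ler_addgt0Pl => e e0; rewrite addr0.
  have /cvgrPdist_lt /(_ e e0)[d /= d0 dP] := cG m x0.
  have [z /andP[_ zd] Gz] := accm _ d0.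
  by have := dP z; rewrite Gz subr0 /ball/= distrC => /(_ zd)/ltW.
have accS m : forall e, 0 < e -> exists2 z, 0 < `|z - x0| < e & G m z = 0.
  elim: m => // m IH e e0.
  have G0 := acc0 m IH.
  have [z /andP[z0 ze] Gz] := IH e e0.
  have Rol a b : a < b -> G m a = G m b ->
      exists2 c, c \in `]a, b[ & G m.+1 c = 0.
    move=> ab Gab.
    have [|c cab dc] := Rolle ab (fun x _ => @ex_derive _ _ _ _ _ _ _ (dG m x)) _ Gab.
      by apply: continuous_subspaceT.
    exists c => //; have := @derive_val _ _ _ _ _ _ _ (dG m c).
    by rewrite (@derive_val _ _ _ _ _ _ _ dc).
  have [zx|xz|zx] := ltgtP z x0.
  - have [|c] := Rol _ _ zx; first by rewrite Gz G0.
    rewrite in_itv/= => /andP[zc cx] Gc; exists c => //.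
    move: ze; rewrite !ltr0_norm ?subr_lt0// ?oppr_gt0 ?subr_lt0// cx/=.
    by apply: le_lt_trans; rewrite lerN2 lerD2r ltW.
  - have [|c] := Rol _ _ xz; first by rewrite Gz G0.
    rewrite in_itv/= => /andP[xc cz] Gc; exists c => //.
    move: ze; rewrite !gtr0_norm ?subr_gt0// xc/=.
    by apply: le_lt_trans; rewrite lerD2r ltW.
  - by move: z0; rewrite zx subrr normr0 ltxx.
pose r := (2 * K)^-1.
have r0 : 0 < r by rewrite invr_gt0 mulr_gt0.
have step x : (forall m, G m x = 0) ->
    forall y, `|y - x| <= r -> forall m, G m y = 0.
  move=> Gx y yr m; apply/eqP; rewrite -normr_eq0 eq_le normr_ge0 andbT.
  apply: (@le_geometric_le0 _ _ (M * K ^+ m)) => j.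
  (* Each halving costs one derivative, so [m] and [y] vary in the induction. The mean value theorem
     gives a factor K from [G m.+1] and a factor at most r = 1/(2K) from the distance, hence one
     half in all. *)
  elim: j m y yr => [|j IH] m y yr; first by rewrite expr0 divr1.
  have [c cr] := @MVT_dist _ (G m) (G m.+1) x y (dG m).
  rewrite Gx subr0 => ->; rewrite normrM.
  apply: (le_trans (ler_pM _ _ (IH m.+1 c (le_trans cr yr)) yr)) => //.
  rewrite /r !exprSr -subr_ge0 [X in 0 <= X](_ : _ = 0)//.
  by field; rewrite expf_neq0//= gt_eqF.
have many n : forall y, `|y - x0| <= n%:R * r -> forall m, G m y = 0.
  elim: n => [|n IH] y.
    rewrite mul0r normr_le0 => /eqP/subr0_eq -> m.
    exact: acc0 (accS m).
  (* The intermediate point lies at the fraction n/(n+1) of the way from [x0] to [y]: within n r of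
     [x0], and within r of [y]. *)
  move=> yn; apply: (@step (x0 + (y - x0) * (n%:R / n.+1%:R))).
    apply: IH; rewrite addrC addKr normrM (@ger0_norm _ (_ / _)) ?divr_ge0//.
    rewrite mulrA ler_pdivrMr// (mulrC _ n%:R) -mulrA ler_wpM2l//.
    by rewrite (mulrC r).
  rewrite opprD addrA -{1}(mulr1 (y - x0)) -mulrBr normrM.
  have -> : 1 - n%:R / n.+1%:R = n.+1%:R^-1 :> R.
    by rewrite -[n.+1%:R]natr1; field; rewrite natr1.
  by rewrite (@gtr0_norm _ _^-1) ?invr_gt0// ler_pdivrMr// mulrC.
move=> z; apply: (many (Num.Def.archi_bound (`|z - x0| / r))).
by rewrite -ler_pdivrMr// ltW// archi_boundP// divr_ge0// ltW.
Qed.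

(** * Integration and differentiation on a segment *)

Notation integrable_on a b f :=
  ((@lebesgue_measure _).-integrable `[a, b]%classic (EFin \o f)).
Notation segint a b f := (\int[@lebesgue_measure _]_(x in `[a, b]%classic) f x).

Section SegmentIntegral.
Variables (R : realType) (a b : R).
Implicit Types f g r : R -> R.
Local Notation mu := (@lebesgue_measure R).

Lemma integrable_continuous r :
  {within `[a, b]%classic, continuous r} -> integrable_on a b r.
Proof. by apply: continuous_compact_integrable; exact: segment_compact. Qed.

Lemma integrableM_continuous f r : integrable_on a b f ->
  {within `[a, b]%classic, continuous r} -> integrable_on a b (fun x => f x * r x).
Proof.
move=> fi rc; apply: (@integrableMl _ _ _ mu _ _ (EFin \o f) r) => //.
  exact: measurable_realfun.subspace_continuous_measurable_fun.
have /compact_bounded[M [_ Mr]] := continuous_compact rc (@segment_compact _ a b).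
by exists M; split; rewrite ?num_real // => ? ? ? ?; exact: Mr.
Qed.

Lemma integrable_onD f g : integrable_on a b f -> integrable_on a b g ->
  integrable_on a b (fun x => f x + g x).
Proof.
move=> fi gi.
by apply: eq_integrable (integrableD _ fi gi).
Qed.

Lemma integrable_onZ k f : integrable_on a b f ->
  integrable_on a b (fun x => k * f x).
Proof.
by move=> fi; apply: eq_integrable (integrableZl _ k fi).
Qed.

Lemma integrable_onN f : integrable_on a b f -> integrable_on a b (fun x => - f x).
Proof.
move=> /(integrable_onZ (-1)).
by apply: eq_integrable => // x _ /=; rewrite mulN1r.
Qed.

End SegmentIntegral.

Section PointwiseDerivatives.
Variable R : realType.
Implicit Types (f g : R -> R) (x : R).

Lemma derfD f g x df dg : is_derive x 1 f df -> is_derive x 1 g dg ->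
  is_derive x 1 (fun t => f t + g t) (df + dg).
Proof. by move=> hf hg; exact: is_deriveD. Qed.

Lemma derfM f g x df dg : is_derive x 1 f df -> is_derive x 1 g dg ->
  is_derive x 1 (fun t => f t * g t) (df * g x + f x * dg).
Proof.
move=> hf hg; apply: (is_derive_eq (is_deriveM hf hg)).
by rewrite /GRing.scale/= addrC mulrC.
Qed.

Lemma derfZ k f x df : is_derive x 1 f df ->
  is_derive x 1 (fun t => k * f t) (k * df).
Proof. by move=> hf; exact: is_deriveZ. Qed.

Lemma derfN f x df : is_derive x 1 f df -> is_derive x 1 (fun t => - f t) (- df).
Proof. by move=> hf; exact: is_deriveN. Qed.

Lemma derf_sin k x : is_derive x 1 (fun t => sin (k * t)) (k * cos (k * x)).
Proof.
have h : is_derive x 1 (fun t : R => k * t) (k * 1) by apply: derfZ.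
have := is_derive1_comp (is_derive_sin (k * x)) h.
by rewrite mulr1 mulrC.
Qed.

Lemma derf_cos k x : is_derive x 1 (fun t => cos (k * t)) (- (k * sin (k * x))).
Proof.
have h : is_derive x 1 (fun t : R => k * t) (k * 1) by apply: derfZ.
have := is_derive1_comp (is_derive_cos (k * x)) h.
by rewrite mulr1 mulrC mulrN.
Qed.

Lemma continuous_sinM (k : R) : continuous (fun t => sin (k * t)).
Proof.
move=> x; apply/differentiable_continuous/derivable1_diffP.
exact: (@ex_derive _ _ _ _ _ _ _ (derf_sin k x)).
Qed.

Lemma continuous_cosM (k : R) : continuous (fun t => cos (k * t)).
Proof.
move=> x; apply/differentiable_continuous/derivable1_diffP.
exact: (@ex_derive _ _ _ _ _ _ _ (derf_cos k x)).
Qed.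

End PointwiseDerivatives.

(** * Oscillatory integrals as functions of the frequency *)

Section OscillatoryIntegral.
Variables (R : realType) (T : R).
Hypothesis T0 : 0 < T.
Implicit Types (f g : R -> R).
Local Notation mu := (@lebesgue_measure R).

(** The real part of \int_0^T e^(- i z s) (f s + i g s) ds. The family is closed under
    differentiation in z and contains both the real and the imaginary part of \int_0^T e^(i z s) h s
    ds, so no complex integrand is needed. *)
Definition osc f g (z : R) : R :=
  segint 0 T (fun s => cos (z * s) * f s + sin (z * s) * g s).

Lemma integrable_osc f g z : integrable_on 0 T f -> integrable_on 0 T g ->
  integrable_on 0 T (fun s => cos (z * s) * f s + sin (z * s) * g s).
Proof.
move=> fi gi; apply: integrable_onD.
  have := integrableM_continuous fi (continuous_subspaceT (@continuous_cosM R z)).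
  by apply: eq_integrable => // s _ /=; rewrite mulrC.
have := integrableM_continuous gi (continuous_subspaceT (@continuous_sinM R z)).
by apply: eq_integrable => // s _ /=; rewrite mulrC.
Qed.

Lemma integrable_onMid f : integrable_on 0 T f ->
  integrable_on 0 T (fun s => s * f s).
Proof.
move=> fi; have := integrableM_continuous fi (continuous_subspaceT (fun x : R => @cvg_id _ (nbhs x))).
by apply: eq_integrable => // s _ /=; rewrite mulrC.
Qed.

Lemma is_derive_osc f g (z : R) : integrable_on 0 T f -> integrable_on 0 T g ->
  is_derive z 1 (osc f g) (osc (fun s => s * g s) (fun s => - (s * f s)) z).
Proof.
move=> fi gi.
pose F z s := cos (z * s) * f s + sin (z * s) * g s.
have dF (x s : R) : is_derive x 1 (F^~ s)
    (cos (x * s) * (s * g s) + sin (x * s) * - (s * f s)).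
  have dc : is_derive x 1 (fun t => cos (t * s)) (- (s * sin (x * s))).
    have -> : (fun t : R => cos (t * s)) = (fun t => cos (s * t)).
      by apply/funext => t; rewrite mulrC.
    by rewrite (mulrC x); exact: derf_cos.
  have ds : is_derive x 1 (fun t => sin (t * s)) (s * cos (x * s)).
    have -> : (fun t : R => sin (t * s)) = (fun t => sin (s * t)).
      by apply/funext => t; rewrite mulrC.
    by rewrite (mulrC x); exact: derf_sin.
  apply: (is_derive_eq (derfD (derfM dc (is_derive_cst (f s) x 1))
                              (derfM ds (is_derive_cst (g s) x 1)))).
  by rewrite /cst; ring.
have d1F x s : partial1of2 F x s =
    cos (x * s) * (s * g s) + sin (x * s) * - (s * f s).
  by rewrite partial1of2E (@derive_val _ _ _ _ _ _ _ (dF x s)).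
(* The factor s produced by differentiation is at most T. This bound does not depend on the
   frequency, so any interval around [z] serves; radius 1 is chosen. *)
pose B s := T * (`|f s| + `|g s|).
have Ii (x : R) : `]z - 1, z + 1[%classic x -> integrable_on 0 T (F x).
  by move=> _; exact: integrable_osc.
have Idz : `]z - 1, z + 1[%classic z.
  by rewrite /= in_itv/= ltrBlDr !ltrDl ltr01.
have Idd (x s : R) : `]z - 1, z + 1[%classic x -> `[0, T]%classic s ->
    derivable (F^~ s) x 1.
  by move=> _ _; exact: (@ex_derive _ _ _ _ _ _ _ (dF x s)).
have B0 s : 0 <= B s by rewrite mulr_ge0 ?addr_ge0// ltW.
have Bi : integrable_on 0 T B.
  by apply/integrable_onZ/integrable_onD; exact: integrable_norm.
have BF (x s : R) : `]z - 1, z + 1[%classic x -> `[0, T]%classic s ->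
    `|partial1of2 F x s| <= B s.
  move=> _; rewrite /= in_itv/= => /andP[s0 sT]; rewrite d1F.
  apply: (le_trans (ler_normD _ _)); rewrite !normrM normrN normrM.
  rewrite /B mulrDr addrC (ger0_norm s0) lerD//.
    apply: (@le_trans _ _ (1 * (s * `|f s|))).
      rewrite ler_wpM2r ?mulr_ge0//.
      by rewrite ler_norml sin_geN1 sin_le1.
    by rewrite mul1r ler_wpM2r.
  apply: (@le_trans _ _ (1 * (s * `|g s|))).
    rewrite ler_wpM2r ?mulr_ge0//.
    by rewrite ler_norml cos_geN1 cos_le1.
  by rewrite mul1r ler_wpM2r.
have mI : measurable (`[0, T]%classic : set (measurableTypeR R)) by [].
have dO := @derivable_under_integral R _ (measurableTypeR R) mu F
  `[0, T]%classic mI z (z - 1) (z + 1) Idz Ii Idd B B0 Bi BF.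
have vO := @differentiation_under_integral R _ (measurableTypeR R) mu F
  `[0, T]%classic mI z (z - 1) (z + 1) Idz Ii Idd B B0 Bi BF.
apply: DeriveDef; first exact: dO.
rewrite -derive1E vO; apply: eq_Rintegral => s _; exact: d1F.
Qed.

Lemma normr_osc_le f g z : integrable_on 0 T f -> integrable_on 0 T g ->
  `|osc f g z| <= segint 0 T (fun s => `|f s| + `|g s|).
Proof.
move=> fi gi; apply: (le_trans (le_normr_Rintegral _ (integrable_osc z fi gi))) => //.
apply: le_Rintegral => //.
- by apply: integrable_norm; exact: integrable_osc.
- by apply: integrable_onD; exact: integrable_norm.
- move=> s _; apply: (le_trans (ler_normD _ _)); rewrite !normrM lerD//.
    by rewrite ler_piMl// ler_norml cos_geN1 cos_le1.
  by rewrite ler_piMl// ler_norml sin_geN1 sin_le1.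
Qed.

(** The m-th derivative is again an oscillatory integral, with amplitudes at most T^m (|f| + |g|);
    this is the geometric bound of [identity_geometric] with K = T. *)
Lemma osc_eq0 f g x0 : integrable_on 0 T f -> integrable_on 0 T g ->
  (forall e, 0 < e -> exists2 z, 0 < `|z - x0| < e & osc f g z = 0) ->
  forall z, osc f g z = 0.
Proof.
move=> fi gi acc.
(* Multiplication of f + i g by - i s, the effect of one differentiation in z. *)
pose D (p : (R -> R) * (R -> R)) :=
  ((fun s => s * p.2 s), (fun s => - (s * p.1 s))).
pose P m := iter m D (f, g).
have Pi m : integrable_on 0 T (P m).1 /\ integrable_on 0 T (P m).2.
  elim: m => [|m [IH1 IH2]]; first by [].
  by split; [exact: integrable_onMid|exact/integrable_onN/integrable_onMid].
have PT m s : 0 <= s <= T ->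
    `|(P m).1 s| + `|(P m).2 s| <= T ^+ m * (`|f s| + `|g s|).
  move=> /andP[s0 sT]; elim: m => [|m IH]; first by rewrite expr0 mul1r.
  rewrite /P iterS -/(P m) /D/= normrN !normrM (ger0_norm s0) -mulrDr exprS -mulrA.
  by rewrite ler_pM ?addr_ge0// addrC.
pose M := segint 0 T (fun s => `|f s| + `|g s|).
pose G m := osc (P m).1 (P m).2.
apply: (@identity_geometric R G M T x0) => //.
  move=> m z; have [p1 p2] := Pi m; exact: is_derive_osc.
move=> m z; have [p1 p2] := Pi m; apply: (le_trans (normr_osc_le _ p1 p2)).
rewrite /M mulrC -RintegralZl//; last first.
  by apply: integrable_onD; exact: integrable_norm.
apply: le_Rintegral => //.
- by apply: integrable_onD; exact: integrable_norm.
- by apply/integrable_onZ/integrable_onD; exact: integrable_norm.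
- by move=> s; rewrite /= in_itv/=; exact: PT.
Qed.

End OscillatoryIntegral.

(** * Modes of the controlled system, in real form *)

Section WithinContinuity.
Variables (R : realType) (A : set R).
Implicit Types f g : R -> R.

Lemma within_continuousD f g : {within A, continuous f} ->
  {within A, continuous g} -> {within A, continuous (fun x => f x + g x)}.
Proof. by move=> cf cg x; apply: continuousD; [exact: cf|exact: cg]. Qed.

Lemma within_continuousM f g : {within A, continuous f} ->
  {within A, continuous g} -> {within A, continuous (fun x => f x * g x)}.
Proof. by move=> cf cg x; apply: continuousM; [exact: cf|exact: cg]. Qed.

Lemma within_continuousN f : {within A, continuous f} ->
  {within A, continuous (fun x => - f x)}.
Proof. by move=> cf x; apply: continuousN; exact: cf. Qed.

Lemma within_continuousZ k f : {within A, continuous f} ->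
  {within A, continuous (fun x => k * f x)}.
Proof.
by move=> cf; apply: within_continuousM => //; apply: continuous_subspaceT; exact: cst_continuous.
Qed.

End WithinContinuity.

Lemma FTC2_within (R : realType) (a b : R) (F f : R -> R) : a < b ->
  {within `[a, b]%classic, continuous f} -> {within `[a, b]%classic, continuous F} ->
  (forall x, x \in `]a, b[ -> is_derive x 1 F (f x)) ->
  segint a b f = F b - F a.
Proof.
move=> ab cf cF dF.
have [_ Fa Fb] := (continuous_within_itvP _ ab).1 cF.
rewrite /Rintegral (@continuous_FTC2 _ f F)//.
  by split => // x xab; exact: (@ex_derive _ _ _ _ _ _ _ (dF x xab)).
by move=> x xab; rewrite derive1E (@derive_val _ _ _ _ _ _ _ (dF x xab)).
Qed.

Section ForcedRotation.
Variables (R : realType) (T mu beta a1 a2 : R) (A1 A2 k1 k2 : R -> R).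
Hypotheses (T0 : 0 < T).
Hypotheses (k1i : integrable_on 0 T k1) (k2i : integrable_on 0 T k2).
Hypotheses (cA1 : {within `[0, T]%classic, continuous A1})
  (cA2 : {within `[0, T]%classic, continuous A2}).
Let H1 t := segint 0 t k1.
Let H2 t := segint 0 t k2.
Hypotheses
  (A1E : forall t, 0 <= t <= T ->
    A1 t = a1 + segint 0 t (fun s => mu * A2 s - beta * k1 s))
  (A2E : forall t, 0 <= t <= T ->
    A2 t = a2 + segint 0 t (fun s => - (mu * A1 s) - beta * k2 s)).
Hypotheses (A1T : A1 T = 0) (A2T : A2 T = 0) (H1T : H1 T = 0) (H2T : H2 T = 0).

(* [A1 + beta H1] and [A2 + beta H2] are C^1 although A1 and A2 are merely
   absolutely continuous; rotating this pair by the angle mu t removes the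
   homogeneous part of the system. *)
Lemma forced_rotation_moments :
  a1 = mu * beta * osc T H2 H1 mu /\
  a2 = mu * beta * osc T (fun s => - H1 s) H2 mu.
Proof.
(* Only the continuous part of each integrand is kept; [pE] and [qE] identify [p] and [q] with
   [A1 + beta H1] and [A2 + beta H2]. *)
pose p t := a1 + segint 0 t (fun s => mu * A2 s).
pose q t := a2 + segint 0 t (fun s => - (mu * A1 s)).
have sub t : t <= T -> `[0, t]%classic `<=` `[0, T]%classic.
  by move=> tT; apply: subset_itvl; rewrite bnd_simp.
have i0t (t : R) (f : R -> R) : t <= T -> integrable_on 0 T f -> integrable_on 0 t f.
  by move=> tT; apply: integrableS => //; exact: sub.
have i2 := integrable_continuous (within_continuousZ (k := mu) cA2).
have i1 := integrable_continuous (within_continuousN (within_continuousZ (k := mu) cA1)).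
have pE t : 0 <= t <= T -> A1 t = p t - beta * H1 t.
  move=> tT; have /andP[_ tT'] := tT; rewrite A1E// /p -addrA; congr (_ + _).
  rewrite RintegralB//; first by rewrite [X in _ - X = _]RintegralZl//; exact: (i0t t _ tT' k1i).
  - exact: (i0t t _ tT' i2).
  - by apply: integrable_onZ; exact: (i0t t _ tT' k1i).
have qE t : 0 <= t <= T -> A2 t = q t - beta * H2 t.
  move=> tT; have /andP[_ tT'] := tT; rewrite A2E// /q -addrA; congr (_ + _).
  rewrite RintegralB//; first by rewrite [X in _ - X = _]RintegralZl//; exact: (i0t t _ tT' k2i).
  - exact: (i0t t _ tT' i1).
  - by apply: integrable_onZ; exact: (i0t t _ tT' k2i).
have cI f : integrable_on 0 T f -> {within `[0, T]%classic, continuous (fun t => segint 0 t f)}.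
  by move=> fi; exact: parameterized_integral_continuous (ltW T0) fi.
have cst_w (c : R) : {within `[0, T]%classic, continuous (fun _ : R => c)}.
  by apply: continuous_subspaceT; exact: cst_continuous.
have cp : {within `[0, T]%classic, continuous p} by apply: within_continuousD => //; exact: cI.
have cq : {within `[0, T]%classic, continuous q} by apply: within_continuousD => //; exact: cI.
have cH1 : {within `[0, T]%classic, continuous H1} by exact: cI.
have cH2 : {within `[0, T]%classic, continuous H2} by exact: cI.
have ccos := continuous_subspaceT (A := `[0, T]%classic) (@continuous_cosM R mu).
have csin := continuous_subspaceT (A := `[0, T]%classic) (@continuous_sinM R mu).
have dI f x : {within `[0, T]%classic, continuous f} -> x \in `]0, T[ ->
    is_derive x 1 (fun t => segint 0 t f) (f x).
  move=> cf x0T; have := x0T; rewrite in_itv/= => /andP[x0 xT].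
  have cfx := within_continuous_continuous T0 cf x0T.
  have [d v] := continuous_FTC1_closed xT (integrable_continuous cf) x0 cfx.
  by apply: DeriveDef => //; rewrite -derive1E.
have oo x : x \in `]0, T[ -> 0 <= x <= T.
  by rewrite in_itv/= => /andP[x0 xT]; rewrite !ltW.
have dp x : x \in `]0, T[ -> is_derive x 1 p (mu * (q x - beta * H2 x)).
  move=> x0T; rewrite -(qE x (oo x x0T)).
  apply: (is_derive_eq (derfD (is_derive_cst a1 x 1) (dI _ _ (within_continuousZ (k := mu) cA2) x0T))).
  by rewrite add0r.
have dq x : x \in `]0, T[ -> is_derive x 1 q (- (mu * (p x - beta * H1 x))).
  move=> x0T; rewrite -(pE x (oo x x0T)).
  apply: (is_derive_eq (derfD (is_derive_cst a2 x 1) (dI _ _ (within_continuousN (within_continuousZ (k := mu) cA1)) x0T))).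
  by rewrite add0r.
have p0 : p 0 = a1 by rewrite /p set_itv1 Rintegral_set1 addr0.
have q0 : q 0 = a2 by rewrite /q set_itv1 Rintegral_set1 addr0.
have T0T : 0 <= T <= T by rewrite lexx ltW.
have pT : p T = 0.
  by have := pE T T0T; rewrite A1T H1T mulr0 subr0.
have qT : q T = 0.
  by have := qE T T0T; rewrite A2T H2T mulr0 subr0.
have H1i := integrable_continuous cH1.
have H2i := integrable_continuous cH2.
split.
  (* Minus the real part of e^(i mu t) (p + i q). The derivative of that product is i mu beta e^(i
     mu t) (H1 + i H2), free of [p] and [q]; the sign makes F T - F 0 equal to [a1]. *)
  pose F t := - (cos (mu * t) * p t) + sin (mu * t) * q t.
  pose f t := mu * beta * (cos (mu * t) * H2 t + sin (mu * t) * H1 t).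
  have cf : {within `[0, T]%classic, continuous f}.
    by apply/within_continuousZ/within_continuousD; apply: within_continuousM.
  have cF : {within `[0, T]%classic, continuous F}.
    by apply: within_continuousD; [apply: within_continuousN|]; apply: within_continuousM.
  have dF x : x \in `]0, T[ -> is_derive x 1 F (f x).
    move=> x0T; apply: (is_derive_eq (derfD (derfN (derfM (derf_cos mu x) (dp x x0T)))
      (derfM (derf_sin mu x) (dq x x0T)))).
    by rewrite /f; ring.
  rewrite /osc -RintegralZl//; last exact: integrable_osc.
  rewrite (FTC2_within T0 cf cF dF) /F pT qT !mulr0 sin0 cos0 mul0r mul1r p0.
  by rewrite !addr0 oppr0 sub0r opprK.
(* Minus the imaginary part of the same product. *)
pose F t := - (sin (mu * t) * p t) - cos (mu * t) * q t.
pose f t := mu * beta * (cos (mu * t) * - H1 t + sin (mu * t) * H2 t).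
have cf : {within `[0, T]%classic, continuous f}.
  apply/within_continuousZ/within_continuousD; apply: within_continuousM => //.
  exact: within_continuousN.
have cF : {within `[0, T]%classic, continuous F}.
  by apply: within_continuousD; apply: within_continuousN; apply: within_continuousM.
have dF x : x \in `]0, T[ -> is_derive x 1 F (f x).
  move=> x0T; apply: (is_derive_eq (derfD (derfN (derfM (derf_sin mu x) (dp x x0T)))
    (derfN (derfM (derf_cos mu x) (dq x x0T))))).
  by rewrite /f; ring.
rewrite /osc -RintegralZl//; last first.
  by apply: integrable_osc => //; exact: integrable_onN.
rewrite (FTC2_within T0 cf cF dF) /F pT qT !mulr0 sin0 cos0 mul0r mul1r q0.
by rewrite oppr0 !add0r opprK.
Qed.

End ForcedRotation.

(** * Integration by parts against sines *)

Section TriangleFubini.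
Variables (R : realType) (a b : R) (f s : R -> R).
Hypotheses (fi : integrable_on a b f) (si : integrable_on a b s).
Local Notation mu := (@lebesgue_measure R).

Let u : R -> R := f \_ `[a, b].
Let v : R -> R := s \_ `[a, b].
(** The product s(x) f(y) cut off to the triangle a <= y <= x <= b: the zero extensions [u] and [v]
    supply the outer bounds and the test supplies the diagonal, so that Fubini applies on the whole
    plane. *)
Let F (p : R * R) := (if p.2 <= p.1 then v p.1 * u p.2 else 0)%:E.

Let restrict_integrable g : integrable_on a b g ->
  mu.-integrable setT (EFin \o (g \_ `[a, b])).
Proof. by move=> gi; rewrite -restrict_EFin; apply/integrable_restrict => //=; rewrite setTI. Qed.

Let mem_itv (c d z : R) : (z \in `[c, d]%classic) = (c <= z <= d).
Proof. by rewrite mem_setE in_itv. Qed.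

Let mF : measurable_fun [set: measurableTypeR R * measurableTypeR R] F.
Proof.
have /measurable_int/measurable_EFinP mu_ := restrict_integrable fi.
have /measurable_int/measurable_EFinP mv_ := restrict_integrable si.
apply/measurable_EFinP; apply: measurable_fun_ifT => //.
  exact: measurable_fun_ler measurable_snd measurable_fst.
by apply: measurable_funM; [exact: measurableT_comp mv_ measurable_fst|
  exact: measurableT_comp mu_ measurable_snd].
Qed.

(** |F(x, y)| <= |v x| |u y|, whose iterated integral is the product of two finite L^1 norms. *)
Let iF : (mu \x mu)%E.-integrable setT F.
Proof.
have ui := restrict_integrable fi; have vi := restrict_integrable si.
apply/integrable12ltyP => //.
apply: (@le_lt_trans _ _ (\int[mu]_x (`|v x|%:E * \int[mu]_y `|(u y)%:E|))%E).
  apply: ge0_le_integral => //.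
  - by move=> x _; exact: integral_ge0.
  - apply: (@measurable_fun_fubini_tonelli_F _ _ _ _ R mu (abse \o F)) => //=.
    exact: measurableT_comp.
  - apply: emeasurable_funM => //.
    apply/measurable_EFinP/measurableT_comp => //.
    by apply/measurable_EFinP; exact: measurable_int vi.
  - move=> x _; rewrite -ge0_integralZl//.
    + apply: ge0_le_integral => //.
      * by apply: measurableT_comp => //; apply: (measurableT_comp mF (measurable_pair1 x)).
      * by apply: measurable_funeM; apply: measurableT_comp => //; exact: measurable_int ui.
      * move=> y _; rewrite /F /= -EFinM lee_fin -normrM.
        by case: ifP => // _; rewrite normr0.
    + by apply: measurableT_comp => //; exact: measurable_int ui.
have /integrableP[_ uy] := ui; have /integrableP[mv vy] := vi.
rewrite ge0_integralZr//.
- by rewrite lte_mul_pinfty ?ge0_fin_numE//; exact: integral_ge0.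
- by apply/measurable_EFinP/measurableT_comp => //; apply/measurable_EFinP.
- exact: integral_ge0.
Qed.

(** The two sides are the iterated integrals of [F] in the two orders. *)
Lemma integral_triangle :
  segint a b (fun x => s x * segint a x f) =
  segint a b (fun y => f y * segint y b s).
Proof.
have sub c d : a <= c -> d <= b -> `[c, d]%classic `<=` `[a, b]%classic.
  by move=> ac db; apply: subset_itv; rewrite bnd_simp.
have in1 (x : R) : (\int[mu]_y F (x, y))%E =
    ((EFin \o (fun x => s x * segint a x f)) \_ `[a, b]) x.
  rewrite patchE mem_itv; case: ifPn => [/andP[ax xb]|xab]; last first.
    apply: integral0_eq => y _; rewrite /F /v/= patchE mem_itv (negbTE xab) mul0r.
    by rewrite if_same.
  have fx : integrable_on a x f by apply: integrableS fi => //; exact: sub.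
  rewrite /= -RintegralZl//; rewrite /Rintegral fineK; last first.
    by apply: integrable_fin_num => //; exact: integrable_onZ.
  rewrite [RHS]integral_mkcond; apply: eq_integral => y _.
  rewrite /F /u /v/= !patchE !mem_itv ax xb/=.
  case: (leP y x) => [yx|]; last by rewrite andbF.
  by rewrite (le_trans yx xb) !andbT; case: ifP => // _; rewrite mulr0.
have in2 (y : R) : (\int[mu]_x F (x, y))%E =
    ((EFin \o (fun y => f y * segint y b s)) \_ `[a, b]) y.
  rewrite patchE mem_itv; case: ifPn => [/andP[ay yb]|yab]; last first.
    apply: integral0_eq => x _; rewrite /F /u/= patchE mem_itv (negbTE yab) mulr0.
    by rewrite if_same.
  have sy : integrable_on y b s by apply: integrableS si => //; exact: sub.
  rewrite /= -RintegralZl//; rewrite /Rintegral fineK; last first.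
    by apply: integrable_fin_num => //; exact: integrable_onZ.
  rewrite [RHS]integral_mkcond; apply: eq_integral => x _.
  rewrite /F /u /v/= !patchE !mem_itv ay yb/=.
  case: (leP y x) => [yx|//].
  by rewrite (le_trans ay yx)/= mulrC; case: ifP => // _; rewrite mulr0.
rewrite /Rintegral; congr fine.
rewrite [LHS]integral_mkcond [RHS]integral_mkcond.
transitivity (\int[mu]_x \int[mu]_y F (x, y))%E.
  by apply: eq_integral => x _; rewrite in1.
rewrite (@Fubini _ _ _ _ R mu mu F iF).
by apply: eq_integral => y _; rewrite in2.
Qed.

End TriangleFubini.

(** * Explicit trigonometric integrals *)

Section Trigonometric.
Variable R : realType.
Implicit Types (al be x : R) (f : R -> R).

Lemma continuous_of_derive (F f : R -> R) :
  (forall x, is_derive x 1 F (f x)) -> continuous F.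
Proof.
move=> dF x; apply/differentiable_continuous/derivable1_diffP.
exact: (@ex_derive _ _ _ _ _ _ _ (dF x)).
Qed.

Lemma FTC2_global (a b : R) (F f : R -> R) : a < b -> continuous f ->
  (forall x, is_derive x 1 F (f x)) -> segint a b f = F b - F a.
Proof.
move=> ab cf dF; apply: FTC2_within => //; apply: continuous_subspaceT => //.
exact: continuous_of_derive dF.
Qed.

Lemma integral_sinM al (y : R) : y <= 1 ->
  al * segint y 1 (fun x => sin (al * x)) = cos (al * y) - cos al.
Proof.
rewrite le_eqVlt => /predU1P[->|y1].
  by rewrite set_itv1 Rintegral_set1 mulr0 mulr1 subrr.
rewrite -RintegralZl//; last first.
  by apply/integrable_continuous/continuous_subspaceT; exact: continuous_sinM.
have dF (x : R) : is_derive x 1 (fun x => - cos (al * x)) (al * sin (al * x)).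
  by apply: (is_derive_eq (derfN (derf_cos al x))); rewrite opprK.
rewrite (FTC2_global y1 _ dF); first by rewrite mulr1 opprK addrC.
by apply: continuous_of_derive => x; exact: (derfZ al (derf_sin al x)).
Qed.

(* The primitive of f is only absolutely continuous, so this integration by parts
   goes through Fubini's theorem on a triangle. *)
Lemma integral_primitive_sin al f : integrable_on 0 1 f -> segint 0 1 f = 0 ->
  al * segint 0 1 (fun x => sin (al * x) * segint 0 x f) =
  segint 0 1 (fun x => f x * cos (al * x)).
Proof.
move=> fi f0.
have si : integrable_on 0 1 (fun x => sin (al * x)).
  by apply/integrable_continuous/continuous_subspaceT; exact: continuous_sinM.
have fc : integrable_on 0 1 (fun x => f x * cos (al * x)).
  apply: integrableM_continuous => //.
  by apply: continuous_subspaceT; exact: continuous_cosM.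
rewrite (integral_triangle fi si).
(* After the exchange of integrals the inner sine integral is explicit. Its endpoint contribution
   [cos al] multiplies the integral of [f], which is zero. *)
have E (x : R) : x \in `[0, 1]%classic ->
    al * (f x * segint x 1 (fun x => sin (al * x))) =
    f x * cos (al * x) - cos al * f x.
  rewrite mem_setE in_itv/= => /andP[_ x1].
  by rewrite mulrCA integral_sinM// mulrBr (mulrC (cos al)).
rewrite -RintegralZl//; last first.
  (* Integrability is obtained by dividing the identity [E] by [al], hence the separate case. *)
  have [->|al0] := eqVneq al 0.
    apply/(eq_integrable _ (cst 0%E)); last exact: integrable0.
      by [].
    move=> x _ /=; rewrite (_ : (fun _ => _) = cst 0) ?Rintegral_cst ?mul0r ?mulr0//.
    by apply/funext => ? /=; rewrite mul0r sin0.
  have := integrable_onZ al^-1 (integrable_onD fc (integrable_onN (integrable_onZ (cos al) fi))).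
  apply: eq_integrable => // x x01 /=.
  by rewrite -E// mulKf.
transitivity (segint 0 1 (fun x => f x * cos (al * x) - cos al * f x)).
  by apply: eq_Rintegral => x; exact: E.
rewrite RintegralB//; last exact: integrable_onZ.
by rewrite [X in _ - X = _]RintegralZl// f0 mulr0 subr0.
Qed.

Lemma integral_cosM al : al != 0 -> sin al = 0 ->
  segint 0 1 (fun x => cos (al * x)) = 0.
Proof.
move=> al0 sal.
have dF (x : R) : is_derive x 1 (fun x => al^-1 * sin (al * x)) (cos (al * x)).
  by apply: (is_derive_eq (derfZ al^-1 (derf_sin al x))); rewrite mulKf.
rewrite (FTC2_global _ _ dF)//; last exact: continuous_cosM.
by rewrite mulr1 sal !mulr0 sin0 mulr0 subrr.
Qed.

(** Source of the coupling coefficient: [x] is the profile that lifts the boundary value. The result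
    is nonzero because [cos al] is, by [cos_neq0]. *)
Lemma integral_id_sinM al : al != 0 -> sin al = 0 ->
  segint 0 1 (fun x => x * sin (al * x)) = - (cos al / al).
Proof.
move=> al0 sal.
have dF x : is_derive x 1
    (fun x => al^-2 * sin (al * x) - al^-1 * (x * cos (al * x))) (x * sin (al * x)).
  apply: (is_derive_eq (derfD (derfZ (al^-2) (derf_sin al x))
    (derfN (derfZ (al^-1) (derfM (is_derive_id x 1) (derf_cos al x)))))).
  by field.
rewrite (FTC2_global _ _ dF)//.
  by rewrite !mulr1 sal !mulr0 sin0 !mul0r !mulr0 !subr0 sub0r mul1r mulrC.
apply: (@continuous_of_derive _ (fun x => sin (al * x) + x * (al * cos (al * x)))) => x.
apply: (is_derive_eq (derfM (is_derive_id x 1) (derf_sin al x))).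
by rewrite mul1r.
Qed.

Lemma integral_coscos al be : sin al = 0 -> sin be = 0 -> al ^+ 2 != be ^+ 2 ->
  segint 0 1 (fun x => cos (al * x) * cos (be * x)) = 0.
Proof.
move=> sal sbe abne.
have ab0 : al ^+ 2 - be ^+ 2 != 0 by rewrite subr_eq0.
(* The Wronskian of the two cosines over the difference of their eigenvalues for - d^2/dx^2; it
   vanishes at both endpoints. The sine case below uses the Wronskian of the two sines. *)
pose F x := (al ^+ 2 - be ^+ 2)^-1 *
  (al * (sin (al * x) * cos (be * x)) - be * (cos (al * x) * sin (be * x))).
have dF x : is_derive x 1 F (cos (al * x) * cos (be * x)).
  apply: (is_derive_eq (derfZ (al ^+ 2 - be ^+ 2)^-1
    (derfD (derfZ al (derfM (derf_sin al x) (derf_cos be x)))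
     (derfN (derfZ be (derfM (derf_cos al x) (derf_sin be x))))))).
  by field.
rewrite (FTC2_global _ _ dF)//.
  by rewrite /F !mulr1 !mulr0 sal sbe sin0 !mulr0 !mul0r !mulr0 subrr.
exact: (continuous_of_derive (fun x => derfM (derf_cos al x) (derf_cos be x))).
Qed.

Lemma integral_sinsin al be : sin al = 0 -> sin be = 0 -> al ^+ 2 != be ^+ 2 ->
  segint 0 1 (fun x => sin (al * x) * sin (be * x)) = 0.
Proof.
move=> sal sbe abne.
have ab0 : al ^+ 2 - be ^+ 2 != 0 by rewrite subr_eq0.
pose F x := (al ^+ 2 - be ^+ 2)^-1 *
  (be * (sin (al * x) * cos (be * x)) - al * (cos (al * x) * sin (be * x))).
have dF x : is_derive x 1 F (sin (al * x) * sin (be * x)).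
  apply: (is_derive_eq (derfZ (al ^+ 2 - be ^+ 2)^-1
    (derfD (derfZ be (derfM (derf_sin al x) (derf_cos be x)))
     (derfN (derfZ al (derfM (derf_cos al x) (derf_sin be x))))))).
  by field.
rewrite (FTC2_global _ _ dF)//.
  by rewrite /F !mulr1 !mulr0 sal sbe sin0 !mulr0 !mul0r !mulr0 subrr.
exact: (continuous_of_derive (fun x => derfM (derf_sin al x) (derf_sin be x))).
Qed.

Lemma sin_intpi (n : int) : sin (n%:~R * pi) = 0 :> R.
Proof.
suff H (m : nat) : sin (m%:R * pi) = 0 :> R.
  by case: n => n; rewrite ?NegzE ?mulrNz ?mulNr ?sinN H ?oppr0.
elim: m => [|m IH]; first by rewrite mul0r sin0.
by rewrite -natr1 mulrDl mul1r sinDpi IH oppr0.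
Qed.

Lemma cos_neq0 al : sin al = 0 -> cos al != 0.
Proof.
move=> s0; apply/eqP => c0; have := cos2Dsin2 al.
by rewrite s0 c0 !expr0n/= addr0 => /eqP; rewrite eq_sym oner_eq0.
Qed.

End Trigonometric.

(** * Complex-valued integrals *)

(** Negation exchanges the positive and negative parts, and [fine] sends both infinities to 0, so
    the identity also covers non-integrable functions; [L2ipN] and [L2ipC] inherit this
    generality. *)
Lemma RintegralN d (T : measurableType d) (R : realType)
    (nu : {measure set T -> \bar R}) (D : set T) (f : T -> R) :
  (\int[nu]_(x in D) - f x = - \int[nu]_(x in D) f x)%R.
Proof.
rewrite /Rintegral integralE [in RHS]integralE.
have -> : (fun x => (- f x)%:E) = (\- (EFin \o f))%E by [].
rewrite funeposN funenegN.
set A := integral _ _ _; set B := integral _ _ _.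
case: A => [r| |]; case: B => [q| |] //=; rewrite ?oppr0 ?opprB //.
Qed.

Section ComplexIntegral.
Variable R : realType.
Local Notation C := R[i].
Implicit Types (f g : R -> C) (r : R -> R).

Lemma cintE (D : set R) f : cint D f =
  Complex (\int[@lebesgue_measure R]_(x in D) complex.Re (f x))
          (\int[@lebesgue_measure R]_(x in D) complex.Im (f x)).
Proof. by []. Qed.

Lemma eq_cint (D : set R) f g : {in D, f =1 g} -> cint D f = cint D g.
Proof. by move=> fg; rewrite /cint; congr Complex; apply: eq_Rintegral => x xD; rewrite fg. Qed.

Lemma ReN (z : C) : complex.Re (- z) = - complex.Re z. Proof. by case: z. Qed.
Lemma ImN (z : C) : complex.Im (- z) = - complex.Im z. Proof. by case: z. Qed.
Lemma ReB (z w : C) : complex.Re (z - w) = complex.Re z - complex.Re w.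
Proof. by case: z w => ? ? []. Qed.
Lemma ImB (z w : C) : complex.Im (z - w) = complex.Im z - complex.Im w.
Proof. by case: z w => ? ? []. Qed.
Lemma ReD (z w : C) : complex.Re (z + w) = complex.Re z + complex.Re w.
Proof. by case: z w => ? ? []. Qed.
Lemma ImD (z w : C) : complex.Im (z + w) = complex.Im z + complex.Im w.
Proof. by case: z w => ? ? []. Qed.
Lemma ReM (z w : C) : complex.Re (z * w) =
  complex.Re z * complex.Re w - complex.Im z * complex.Im w.
Proof. by case: z w => ? ? []. Qed.
Lemma ImM (z w : C) : complex.Im (z * w) =
  complex.Re z * complex.Im w + complex.Im z * complex.Re w.
Proof. by case: z w => ? ? []. Qed.
Lemma ReJ (z : C) : complex.Re (z^*) = complex.Re z. Proof. by case: z. Qed.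
Lemma ImJ (z : C) : complex.Im (z^*) = - complex.Im z. Proof. by case: z. Qed.

Lemma L2ipN f g : L2ip (fun x => - f x) g = - L2ip f g.
Proof.
rewrite /L2ip /cint.
under eq_Rintegral do rewrite mulNr ReN.
under [X in Complex _ X]eq_Rintegral do rewrite mulNr ImN.
by rewrite !RintegralN.
Qed.

Lemma L2ipC f g : L2ip f g = (L2ip g f)^*.
Proof.
transitivity (Complex (segint 0 1 (fun x => complex.Re (g x * (f x)^*)))
  (- segint 0 1 (fun x => complex.Im (g x * (f x)^*)))); last by [].
rewrite -RintegralN /L2ip /cint; congr Complex; apply: eq_Rintegral => x _.
  by rewrite !ReM !ReJ !ImJ; ring.
by rewrite !ImM !ReJ !ImJ; ring.
Qed.

Lemma L2ip_real f r : L2ip f (fun x => (r x)%:C%C) =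
  Complex (segint 0 1 (fun x => complex.Re (f x) * r x))
          (segint 0 1 (fun x => complex.Im (f x) * r x)).
Proof.
rewrite /L2ip /cint; congr Complex; apply: eq_Rintegral => x _.
  by rewrite ReM ReJ ImJ /= oppr0 mulr0 subr0.
by rewrite ImM ReJ ImJ /= oppr0 mulr0 add0r.
Qed.

(** Conjugation turns i into - i, and - i z has real part Im z and imaginary part - Re z. *)
Lemma L2ip_imag f r : L2ip f (fun x => 'i%C * (r x)%:C%C) =
  Complex (segint 0 1 (fun x => complex.Im (f x) * r x))
          (- segint 0 1 (fun x => complex.Re (f x) * r x)).
Proof.
rewrite -RintegralN /L2ip /cint; congr Complex; apply: eq_Rintegral => x _.
  by rewrite ReM ReJ ImJ ReM ImM /=; ring.
by rewrite ImM ReJ ImJ ReM ImM /=; ring.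
Qed.

Lemma L2ip0r f : L2ip f (fun=> 0) = 0.
Proof.
rewrite (L2ip_real f (fun=> 0)).
by under eq_Rintegral do rewrite mulr0;
  under [X in Complex _ X]eq_Rintegral do rewrite mulr0; rewrite Rintegral_cst// mul0r.
Qed.

(** Componentwise, to match [cint]. *)
Definition ccontinuous f :=
  continuous (fun x => complex.Re (f x)) /\ continuous (fun x => complex.Im (f x)).

Lemma ccontinuousM f g : ccontinuous f -> ccontinuous g ->
  ccontinuous (fun x => f x * g x).
Proof.
move=> [f1 f2] [g1 g2]; split => x.
  under eq_fun do rewrite ReM.
  by apply: cvgB; apply: cvgM; [exact: f1|exact: g1|exact: f2|exact: g2].
under eq_fun do rewrite ImM.
by apply: cvgD; apply: cvgM; [exact: f1|exact: g2|exact: f2|exact: g1].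
Qed.

Lemma ccontinuousJ f : ccontinuous f -> ccontinuous (fun x => (f x)^*).
Proof.
move=> [f1 f2]; split => x.
  by under eq_fun do rewrite ReJ; exact: f1.
by under eq_fun do rewrite ImJ; apply: cvgN; exact: f2.
Qed.

Lemma ccontinuousD f g : ccontinuous f -> ccontinuous g ->
  ccontinuous (fun x => f x + g x).
Proof.
move=> [f1 f2] [g1 g2]; split => x.
  by under eq_fun do rewrite ReD; apply: cvgD; [exact: f1|exact: g1].
by under eq_fun do rewrite ImD; apply: cvgD; [exact: f2|exact: g2].
Qed.

Lemma ccontinuous_cst (k : C) : ccontinuous (fun=> k).
Proof. by split => x; exact: cvg_cst. Qed.

Lemma ccontinuous_real r : continuous r -> ccontinuous (fun x => (r x)%:C%C).
Proof. by move=> rc; split => x //=; exact: cvg_cst. Qed.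

Lemma ccontinuous_sum (s : seq int) (c : int -> C) (F : int -> R -> C) :
  (forall n, ccontinuous (F n)) -> ccontinuous (fun x => \sum_(n <- s) c n * F n x).
Proof.
move=> Fc; elim: s => [|n s IH].
  by under eq_fun do rewrite big_nil; exact: ccontinuous_cst.
under eq_fun do rewrite big_cons.
by apply: ccontinuousD => //; apply: ccontinuousM => //; exact: ccontinuous_cst.
Qed.

Lemma cint_linear (c : C) f g : ccontinuous f -> ccontinuous g ->
  cint `[0, 1]%classic (fun x => c * f x + g x) =
  c * cint `[0, 1]%classic f + cint `[0, 1]%classic g.
Proof.
move=> [f1 f2] [g1 g2].
have ii r : continuous r -> integrable_on 0 1 r.
  by move=> rc; apply/integrable_continuous/continuous_subspaceT.
have f1i := ii _ f1; have f2i := ii _ f2; have g1i := ii _ g1; have g2i := ii _ g2.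
have iZ k r : integrable_on 0 1 r -> integrable_on 0 1 (fun x => k * r x).
  exact: integrable_onZ.
case: c => a b; rewrite /cint.
transitivity (Complex
  (segint 0 1 (fun x => a * complex.Re (f x) - b * complex.Im (f x) + complex.Re (g x)))
  (segint 0 1 (fun x => a * complex.Im (f x) + b * complex.Re (f x) + complex.Im (g x)))).
  by congr Complex; apply: eq_Rintegral => x _; rewrite ?ReD ?ImD ?ReM ?ImM.
have I1 := integrable_onD (iZ a _ f1i) (integrable_onN (iZ b _ f2i)).
have I2 := integrable_onD (iZ a _ f2i) (iZ b _ f1i).
rewrite (RintegralD _ I1 g1i)// (RintegralD _ I2 g2i)//.
rewrite (RintegralB _ (iZ a _ f1i) (iZ b _ f2i))// (RintegralD _ (iZ a _ f2i) (iZ b _ f1i))//.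
by rewrite !(RintegralZl _ _ f1i)// !(RintegralZl _ _ f2i).
Qed.

End ComplexIntegral.

(** * Eigenfunctions *)

Section Eigenfunctions.
Variable R : realType.
Implicit Types (f g : R -> R[i]) (r : R -> R) (n m : int).

Lemma L2_ccontinuous (a b : R) f : ccontinuous f -> L2 a b f.
Proof.
move=> [f1 f2]; split; [|split].
- by apply: subspace_continuous_measurable_fun => //; exact: continuous_subspaceT.
- by apply: subspace_continuous_measurable_fun => //; exact: continuous_subspaceT.
- have c : continuous (fun x => complex.Re (f x) ^+ 2 + complex.Im (f x) ^+ 2).
    by move=> x; apply: cvgD; apply: cvgM; do ?[exact: f1|exact: f2].
  have /integrable_lty := integrable_continuous (continuous_subspaceT (A := `[a, b]%classic) c).
  exact.
Qed.

Lemma is_prim_real (F r : R -> R) : continuous r ->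
  (forall x : R, is_derive x 1 F (r x)) ->
  is_prim 0 1 (fun x => (F x)%:C%C) (fun x => (r x)%:C%C).
Proof.
move=> rc dF; split; first exact/L2_ccontinuous/ccontinuous_real.
move=> x /andP[x0 _]; rewrite cintE /= Rintegral_cst// mul0r.
suff -> : segint 0 x r = F x - F 0.
  by apply/eqP; rewrite eq_complex /= addr0 addrC subrK !eqxx.
move: x0; rewrite le_eqVlt => /predU1P[<-|x0].
  by rewrite set_itv1 Rintegral_set1 subrr.
exact: FTC2_global.
Qed.

Definition wavenumber n : R := n%:~R * pi.
Definition dispersion n : R := Num.sqrt (1 + wavenumber n ^+ 2).
Definition frequency n : R := wavenumber n / dispersion n.

Lemma eigfunE n : n != 0 -> eigfun R n =
  mkHel (fun x => (sin (wavenumber n * x) / dispersion n)%:C%C)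
        (fun x => (wavenumber n * cos (wavenumber n * x) / dispersion n)%:C%C)
        (fun x => 'i%C * (cos (wavenumber n * x))%:C%C).
Proof. by move=> /negbTE n0; rewrite /eigfun n0. Qed.

Lemma sin_wavenumber n : sin (wavenumber n) = 0.
Proof. exact: sin_intpi. Qed.

Lemma wavenumber_eq0 n : (wavenumber n == 0) = (n == 0).
Proof. by rewrite mulf_eq0 intr_eq0 (gt_eqF (pi_gt0 R)) orbF. Qed.

Lemma dispersion_gt0 n : 0 < dispersion n.
Proof. by rewrite sqrtr_gt0 ltr_wpDr// sqr_ge0. Qed.

Lemma dispersion_sqr n : dispersion n ^+ 2 = 1 + wavenumber n ^+ 2.
Proof. by rewrite sqr_sqrtr// addr_ge0// sqr_ge0. Qed.

Lemma continuous_eigu n : continuous (fun x => sin (wavenumber n * x) / dispersion n).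
Proof. by move=> x; apply: cvgM; [exact: continuous_sinM|exact: cvg_cst]. Qed.

Lemma continuous_eigdu n :
  continuous (fun x => wavenumber n * cos (wavenumber n * x) / dispersion n).
Proof.
move=> x; apply: cvgM; [apply: cvgM; [exact: cvg_cst|exact: continuous_cosM]|exact: cvg_cst].
Qed.

Lemma ccontinuous_eigfun n : [/\ ccontinuous (Hu (eigfun R n)),
  ccontinuous (Hdu (eigfun R n)) & ccontinuous (Hv (eigfun R n))].
Proof.
have [->|n0] := eqVneq n 0.
  by rewrite /eigfun eqxx; split; exact: ccontinuous_cst.
rewrite eigfunE//; split => /=.
- exact/ccontinuous_real/continuous_eigu.
- exact/ccontinuous_real/continuous_eigdu.
- by apply: ccontinuousM; [exact: ccontinuous_cst|
    exact/ccontinuous_real/continuous_cosM].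
Qed.

Lemma inH_eigfun n : inH (eigfun R n).
Proof.
have [_ _ vc] := ccontinuous_eigfun n.
split; last exact: L2_ccontinuous.
have [n0|n0] := eqVneq n 0.
  rewrite n0 /eigfun eqxx /=; split => //.
  exact: (is_prim_real (@cst_continuous _ _ 0) (fun x => is_derive_cst 0 x 1)).
rewrite eigfunE//=; split; last by rewrite mulr0 mulr1 sin_wavenumber sin0 mul0r.
apply: is_prim_real; first exact: continuous_eigdu.
move=> x; apply: (is_derive_eq (derfM (derf_sin (wavenumber n) x)
  (is_derive_cst (dispersion n)^-1 x 1))).
by rewrite mulr0 addr0.
Qed.

Lemma L2ip_suml (s : seq int) (c : int -> R[i]) (F : int -> R -> R[i]) g :
  (forall n, ccontinuous (F n)) -> ccontinuous g ->
  L2ip (fun x => \sum_(n <- s) c n * F n x) g = \sum_(n <- s) c n * L2ip (F n) g.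
Proof.
move=> Fc gc; have gJ := ccontinuousJ gc.
elim: s => [|n s IH].
  have -> : (fun x : R => \sum_(n <- [::]) c n * F n x) = fun=> 0.
    by apply/funext => x; rewrite big_nil.
  by rewrite big_nil L2ipC L2ip0r rmorph0.
rewrite big_cons -IH -cint_linear.
- by apply: eq_cint => x _; rewrite big_cons mulrDl mulrA.
- exact: ccontinuousM.
- by apply: ccontinuousM => //; exact: ccontinuous_sum.
Qed.

Definition Hccontinuous (V : Hel R) :=
  [/\ ccontinuous (Hu V), ccontinuous (Hdu V) & ccontinuous (Hv V)].

Lemma Hccontinuous_eigcomb s c : Hccontinuous (eigcomb s c).
Proof.
by split; apply: ccontinuous_sum => n; case: (ccontinuous_eigfun n).
Qed.

Lemma HipC (U V : Hel R) : Hip U V = (Hip V U)^*.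
Proof. by rewrite /Hip /H1ip !rmorphD/= -!L2ipC. Qed.

Lemma Hip_eigcombl s c V : Hccontinuous V ->
  Hip (eigcomb s c) V = \sum_(n <- s) c n * Hip (eigfun R n) V.
Proof.
move=> [V1 V2 V3]; rewrite /Hip /H1ip /eigcomb/=.
rewrite !L2ip_suml//; try by move=> n; case: (ccontinuous_eigfun n).
rewrite -!big_split/=; apply: eq_bigr => n _.
by rewrite !mulrDr.
Qed.

Lemma segint0 (a b : R) : segint a b (fun=> 0) = 0 :> R.
Proof. by rewrite Rintegral_cst// mul0r. Qed.

Lemma segintZ_continuous k (r : R -> R) : continuous r ->
  segint 0 1 (fun x => k * r x) = k * segint 0 1 r.
Proof.
move=> rc; rewrite RintegralZl//.
exact/integrable_continuous/continuous_subspaceT.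
Qed.

Lemma segint_eq0 k (h r : R -> R) : continuous r -> segint 0 1 r = 0 ->
  (forall x, h x = k * r x) -> segint 0 1 h = 0.
Proof.
move=> rc r0 hr; have -> : h = (fun x => k * r x) by apply/funext.
by rewrite segintZ_continuous// r0 mulr0.
Qed.

(** When the squared wavenumbers differ, the integrals that make up the product vanish one by one.
    For m = - n they would only cancel each other; that pair does not arise when |n| exceeds every
    index of U^0. *)
Lemma Hip_eigfun_ortho m n : n != 0 -> m ^+ 2 != n ^+ 2 ->
  Hip (eigfun R m) (eigfun R n) = 0.
Proof.
move=> n0 mn.
have wmn : wavenumber m ^+ 2 != wavenumber n ^+ 2.
  rewrite !exprMn -subr_eq0 -mulrBl mulf_eq0 negb_or subr_eq0 -!rmorphXn/= eqr_int mn/=.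
  by rewrite expf_neq0// gt_eqF// pi_gt0.
have cc : segint 0 1 (fun x => cos (wavenumber m * x) * cos (wavenumber n * x)) = 0.
  by apply: integral_coscos => //; exact: sin_wavenumber.
have ss : segint 0 1 (fun x => sin (wavenumber m * x) * sin (wavenumber n * x)) = 0.
  by apply: integral_sinsin => //; exact: sin_wavenumber.
have ccc : continuous (fun x : R => cos (wavenumber m * x) * cos (wavenumber n * x)).
  by move=> x; apply: cvgM; exact: continuous_cosM.
have ssc : continuous (fun x : R => sin (wavenumber m * x) * sin (wavenumber n * x)).
  by move=> x; apply: cvgM; exact: continuous_sinM.
rewrite (eigfunE n0) /Hip /H1ip /= !L2ip_real L2ip_imag.
transitivity (Complex 0 0 + Complex 0 0 + Complex 0 (- 0) : R[i]); last first.
  by rewrite oppr0 !addr0.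
(* The constant component of [U_0] is the cosine of wavenumber 0, so the cosine integral covers this
   case too. *)
have [m0|m0] := eqVneq m 0.
  rewrite m0 /eigfun eqxx in cc ccc *.
  congr (Complex _ _ + Complex _ _ + Complex _ (- _));
    [apply: (segint_eq0 (k := 0) ccc cc)..|apply: (segint_eq0 (k := 1) ccc cc)] => x /=;
    by rewrite ?mul0r// /wavenumber mulr0z !mul0r cos0 !mul1r.
rewrite (eigfunE m0) /=.
have dn := gt_eqF (dispersion_gt0 n); have dm := gt_eqF (dispersion_gt0 m).
congr (Complex _ _ + Complex _ _ + Complex _ (- _)).
- apply: (segint_eq0 (k := wavenumber m * wavenumber n / (dispersion m * dispersion n)) ccc cc) => x.
  by field; rewrite dn dm.
- by apply: (segint_eq0 (k := 0) ccc cc) => x; rewrite !mul0r.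
- apply: (segint_eq0 (k := (dispersion m * dispersion n)^-1) ssc ss) => x.
  by field; rewrite dn dm.
- by apply: (segint_eq0 (k := 0) ccc cc) => x; rewrite !mul0r.
- by apply: (segint_eq0 (k := 1) ccc cc) => x; rewrite /=; ring.
- by apply: (segint_eq0 (k := 0) ccc cc) => x; rewrite /=; ring.
Qed.

End Eigenfunctions.

(** * Square-integrable functions *)

Section SquareIntegrable.
Variable R : realType.
Implicit Types (f g : R -> R[i]) (r : R -> R) (a b : R).
Local Notation mu := (@lebesgue_measure R).

Definition sqmod f x : R := complex.Re (f x) ^+ 2 + complex.Im (f x) ^+ 2.

Lemma sqmod_ge0 f x : 0 <= sqmod f x.
Proof. by rewrite addr_ge0// sqr_ge0. Qed.

Lemma L2_integrable_sqmod a b f : L2 a b f -> integrable_on a b (sqmod f).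
Proof.
move=> [mr [mi fy]]; apply/integrableP; split.
  by apply/measurable_EFinP; apply: measurable_funD; apply: measurable_funX.
apply: le_lt_trans fy; apply: ge0_le_integral => //.
- apply: measurableT_comp => //; apply/measurable_EFinP.
  by apply: measurable_funD; apply: measurable_funX.
- by apply/measurable_EFinP; apply: measurable_funD; apply: measurable_funX.
- by move=> x _; rewrite /= lee_fin ger0_norm// sqmod_ge0.
Qed.

Lemma L2_integrable a b f : L2 a b f ->
  integrable_on a b (fun x => complex.Re (f x)) /\
  integrable_on a b (fun x => complex.Im (f x)).
Proof.
move=> fL2; have si := L2_integrable_sqmod fL2; move: fL2 => [mr [mi _]].
have c1 : integrable_on a b (fun=> 1 : R).
  by apply/integrable_continuous/continuous_subspaceT; exact: cst_continuous.
have dom := integrable_onD c1 si.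
have le1 (x y : R) : `|x| <= `|1 + (x ^+ 2 + y ^+ 2)|.
  have y0 := sqr_ge0 y; have x0 := sqr_ge0 x.
  rewrite (@ger0_norm _ (1 + _)); last by rewrite !addr_ge0.
  have := sqr_ge0 (`|x| - 1); rewrite sqrrB real_normK ?num_real//; have := normr_ge0 x.
  by move: `|x| => z; nra.
split; apply: (le_integrable _ _ _ dom) => //.
- exact/measurable_EFinP.
- by move=> x _ /=; rewrite lee_fin le1.
- exact/measurable_EFinP.
- by move=> x _ /=; rewrite lee_fin /sqmod addrC (addrC _ (_ ^+ 2)) addrC le1.
Qed.

Lemma L2B a b f g : L2 a b f -> L2 a b g -> L2 a b (fun x => f x - g x).
Proof.
move=> fL gL; have fs := L2_integrable_sqmod fL; have gs := L2_integrable_sqmod gL.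
move: fL gL => [fr [fi _]] [gr [gi _]].
have mr : measurable_fun `[a, b]%classic (fun x => complex.Re (f x - g x)).
  have -> : (fun x => complex.Re (f x - g x)) = (fun x => complex.Re (f x) - complex.Re (g x)).
    by apply/funext => x; rewrite ReB.
  exact: measurable_funB.
have mi : measurable_fun `[a, b]%classic (fun x => complex.Im (f x - g x)).
  have -> : (fun x => complex.Im (f x - g x)) = (fun x => complex.Im (f x) - complex.Im (g x)).
    by apply/funext => x; rewrite ImB.
  exact: measurable_funB.
split=> //; split=> //.
have /integrable_lty := integrable_onZ 2 (integrable_onD fs gs).
move=> lty; apply: (le_lt_trans _ (lty _)) => //; apply: ge0_le_integral => //.
- by move=> x _; rewrite lee_fin addr_ge0// sqr_ge0.
- by apply/measurable_EFinP; apply: measurable_funD; apply: measurable_funX.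
- apply/measurable_EFinP; apply: measurable_funM => //.
  by apply: measurable_funD; apply: measurable_funD; apply: measurable_funX.
- move=> x _; rewrite lee_fin ReB ImB /sqmod.
  have := sqr_ge0 (complex.Re (f x) + complex.Re (g x)).
  have := sqr_ge0 (complex.Im (f x) + complex.Im (g x)).
  by nra.
Qed.

(* Integrates [|h| <= d + h^2 / d]; choosing d afterwards replaces the
   Cauchy-Schwarz inequality. *)
Lemma pairing_le a b (r h k : R -> R) (d : R) : 0 < d ->
  integrable_on a b h -> integrable_on a b k ->
  {within `[a, b]%classic, continuous r} ->
  (forall x, `|r x| <= 1) -> (forall x, h x ^+ 2 <= k x) ->
  `|segint a b (fun x => h x * r x)| <= segint a b (fun=> d) + segint a b k / d.
Proof.
move=> d0 hi ki rc r1 hk.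
have hr := integrableM_continuous hi rc.
have dc : integrable_on a b (fun=> d).
  by apply/integrable_continuous/continuous_subspaceT; exact: cst_continuous.
have kd : integrable_on a b (fun x => d^-1 * k x) by exact: integrable_onZ.
apply: (le_trans (le_normr_Rintegral _ hr)) => //.
rewrite mulrC -RintegralZl// -RintegralD//; apply: le_Rintegral => //.
- exact: integrable_norm.
- exact: integrable_onD.
- move=> x _; apply: (@le_trans _ _ `|h x|).
    by rewrite normrM ler_piMr.
  rewrite mulrC -(ler_pM2r d0) mulrDl divfK ?gt_eqF//.
  have := sqr_ge0 (`|h x| - d); have := hk x; have := sqr_ge0 d.
  by rewrite sqrrB -[h x ^+ 2]real_normK ?num_real//; move: `|h x| => z; nra.
Qed.

Lemma within_continuous_dist a b r :
  (forall t, a <= t <= b -> forall e, 0 < e -> exists2 d, 0 < d &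
    forall s, a <= s <= b -> `|s - t| < d -> `|r s - r t| < e) ->
  {within `[a, b]%classic, continuous r}.
Proof.
move=> rP; apply/subspace_continuousP => t; rewrite /= in_itv/= => tab.
apply/cvgrPdist_lt => e e0; have [d d0 dP] := rP t tab e e0.
exists d => //= s; rewrite /ball/= distrC => sd; rewrite in_itv/= => sab.
by rewrite distrC; exact: dP.
Qed.

Lemma Hnorm2E (V : Hel R) : Hnorm2 V =
  segint 0 1 (sqmod (Hdu V)) + segint 0 1 (sqmod (Hu V)) + segint 0 1 (sqmod (Hv V)).
Proof.
rewrite /Hnorm2 /Hip /H1ip !ReD /L2ip /=.
by congr (_ + _ + _); apply: eq_Rintegral => x _; rewrite ReM ReJ ImJ /sqmod; ring.
Qed.

Lemma Hnorm2_ge (V : Hel R) :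
  segint 0 1 (sqmod (Hdu V)) <= Hnorm2 V /\ segint 0 1 (sqmod (Hv V)) <= Hnorm2 V.
Proof.
have s0 (f : R -> R[i]) : 0 <= segint 0 1 (sqmod f).
  by apply: Rintegral_ge0 => x _; exact: sqmod_ge0.
by rewrite Hnorm2E; split; rewrite ?lerDr -?addrA ?lerDl addr_ge0.
Qed.

(** [P] stands for [Hdu] or [Hv], and [part] for the real or the imaginary part: one argument yields
    the four continuities needed for a mode. *)
Lemma Hcont_pairing (T : R) (W : R -> Hel R) (P : Hel R -> R -> R[i])
    (part : R[i] -> R) (r : R -> R) :
  (forall V, segint 0 1 (sqmod (P V)) <= Hnorm2 V) ->
  (forall V U x, P (Hsub V U) x = P V x - P U x) ->
  (forall z w, part (z - w) = part z - part w) ->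
  (forall z, part z ^+ 2 <= complex.Re z ^+ 2 + complex.Im z ^+ 2) ->
  (forall f, L2 0 1 f -> integrable_on 0 1 (fun x => part (f x))) ->
  Hcont T W -> (forall t, 0 <= t <= T -> L2 0 1 (P (W t))) ->
  continuous r -> (forall x, `|r x| <= 1) ->
  {within `[0, T]%classic, continuous (fun t => segint 0 1 (fun x => part (P (W t) x) * r x))}.
Proof.
move=> PN PB partB partle parti Wc WL rc r1.
apply: within_continuous_dist => t tT e e0.
have rw : {within `[0, 1]%classic, continuous r} by exact: continuous_subspaceT.
have e2 : 0 < e / 2 by rewrite divr_gt0.
(* With squared norm below (e/2)^2, [pairing_le] at its parameter e/2 gives less than e/2 + (e/2)^2
   / (e/2) = e. *)
have [d d0 dP] := Wc t tT ((e / 2) ^+ 2) (exprn_gt0 _ e2).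
exists d => // s sT st.
have N := dP s sT st.
have fL : L2 0 1 (P (Hsub (W s) (W t))).
  have := L2B (WL s sT) (WL t tT); congr L2.
  by apply/funext => x; rewrite PB.
rewrite -RintegralB//; do ?[by apply: integrableM_continuous => //; apply: parti; exact: WL].
have -> : segint 0 1 (fun x => part (P (W s) x) * r x - part (P (W t) x) * r x) =
    segint 0 1 (fun x => part (P (Hsub (W s) (W t)) x) * r x).
  by apply: eq_Rintegral => x _; rewrite PB partB mulrBl.
have := @pairing_le 0 1 r (fun x => part (P (Hsub (W s) (W t)) x))
  (sqmod (P (Hsub (W s) (W t)))) _ e2 (parti _ fL) (L2_integrable_sqmod fL) rw r1
  (fun x => partle _).
move=> /le_lt_trans; apply.
rewrite Rintegral_cst//= lebesgue_measure_itv/= lte01 oppr0 addr0 mulr1.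
have := le_lt_trans (PN (Hsub (W s) (W t))) N.
rewrite expr2 -ltr_pdivrMr// => lt2.
by rewrite [ltRHS]splitr ltrD2l.
Qed.

(** The boundary condition at 1 becomes the vanishing mean of the derivative, the form in which
    [integral_primitive_sin] uses it. *)
Lemma H10_prim (u g : R -> R[i]) : H10 u g ->
  [/\ forall x, 0 <= x <= 1 -> complex.Re (u x) = segint 0 x (fun y => complex.Re (g y)),
      forall x, 0 <= x <= 1 -> complex.Im (u x) = segint 0 x (fun y => complex.Im (g y)),
      segint 0 1 (fun y => complex.Re (g y)) = 0 &
      segint 0 1 (fun y => complex.Im (g y)) = 0].
Proof.
move=> [[_ up] [u0 u1]].
have H x : 0 <= x <= 1 -> complex.Re (u x) = segint 0 x (fun y => complex.Re (g y)) /\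
    complex.Im (u x) = segint 0 x (fun y => complex.Im (g y)).
  by move=> x01; rewrite (up x x01) u0 add0r.
have [|r1 i1] := H 1; first by rewrite ler01 lexx.
by split => [x /H[]|x /H[]||] //; rewrite -?r1 -?i1 u1.
Qed.

End SquareIntegrable.

(** * Modes of a state and the action of the generator on them *)

Section Modes.
Variable R : realType.
Implicit Types (n : int) (V W : Hel R).

Definition pairdu (part : R[i] -> R) n V :=
  segint 0 1 (fun x => part (Hdu V x) * cos (wavenumber R n * x)).
Definition pairv (part : R[i] -> R) n V :=
  segint 0 1 (fun x => part (Hv V x) * cos (wavenumber R n * x)).
(** With [mode_im], the two components of (V, U_n) for n <> 0, by [Hip_eigfunr]. The contribution of
    u has been absorbed into that of u', so only cosine pairings remain. *)
Definition mode_re n V := pairdu (@complex.Re R) n V / frequency R n + pairv (@complex.Im R) n V.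
Definition mode_im n V := pairdu (@complex.Im R) n V / frequency R n - pairv (@complex.Re R) n V.
(** This is beta_n, the L^2 pairing of [x] with the first component of [U_n]; see
    [segint_id_eigu]. *)
Definition coupling n : R := - (cos (wavenumber R n) / wavenumber R n) / dispersion R n.

Let within_sin n : {within `[0, 1]%classic, continuous (fun x => sin (wavenumber R n * x))}.
Proof. by apply: continuous_subspaceT; exact: continuous_sinM. Qed.

Let within_cos n : {within `[0, 1]%classic, continuous (fun x => cos (wavenumber R n * x))}.
Proof. by apply: continuous_subspaceT; exact: continuous_cosM. Qed.

Let dispersion_neq0 n : dispersion R n != 0.
Proof. by rewrite gt_eqF// dispersion_gt0. Qed.

Let wavenumber_neq0 n : n != 0 -> wavenumber R n != 0.
Proof. by rewrite wavenumber_eq0. Qed.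

Lemma frequency_neq0 n : n != 0 -> frequency R n != 0.
Proof. by move=> n0; rewrite mulf_neq0 ?invr_eq0// wavenumber_neq0. Qed.

(* U_n' and U_n combine into cos / omega_n because
   (wavenumber n)^2 + 1 = (dispersion n)^2. *)
Lemma segint_H1_eigfun n (g w : R -> R) : n != 0 -> integrable_on 0 1 g ->
  segint 0 1 g = 0 -> (forall x, 0 <= x <= 1 -> w x = segint 0 x g) ->
  segint 0 1 (fun x => g x * (wavenumber R n * cos (wavenumber R n * x) / dispersion R n)) +
  segint 0 1 (fun x => w x * (sin (wavenumber R n * x) / dispersion R n)) =
  segint 0 1 (fun x => g x * cos (wavenumber R n * x)) / frequency R n.
Proof.
move=> n0 gi g0 wE; have w0 := wavenumber_neq0 n0.
have gc := integrableM_continuous gi (@within_cos n).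
have -> : segint 0 1 (fun x => g x * (wavenumber R n * cos (wavenumber R n * x) / dispersion R n)) =
    frequency R n * segint 0 1 (fun x => g x * cos (wavenumber R n * x)).
  rewrite -RintegralZl//; apply: eq_Rintegral => x _; rewrite /frequency.
  by field; exact: dispersion_neq0.
have -> : segint 0 1 (fun x => w x * (sin (wavenumber R n * x) / dispersion R n)) =
    (dispersion R n)^-1 * segint 0 1 (fun x => sin (wavenumber R n * x) * segint 0 x g).
  rewrite -RintegralZl//; last first.
    apply: integrable_continuous; apply: within_continuousM => //.
    exact: parameterized_integral_continuous ler01 gi.
  apply: eq_Rintegral => x; rewrite mem_setE in_itv/= => x01; rewrite wE//.
  by field; exact: dispersion_neq0.
rewrite -(integral_primitive_sin (wavenumber R n) gi g0) /frequency.
set S := segint 0 1 (fun x => sin (wavenumber R n * x) * segint 0 x g).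
have d2 : dispersion R n * dispersion R n = 1 + wavenumber R n ^+ 2.
  by rewrite -expr2 dispersion_sqr.
apply: (mulIf (dispersion_neq0 n)).
transitivity ((1 + wavenumber R n ^+ 2) * S).
  by field; exact: dispersion_neq0.
by rewrite -d2; field; rewrite w0 dispersion_neq0.
Qed.

Lemma Hip_eigfunr n V : n != 0 -> inH V ->
  Hip V (eigfun R n) = Complex (mode_re n V) (mode_im n V).
Proof.
move=> n0 [Vu Vv]; have [gr gi] := L2_integrable Vu.1.1.
have [ur ui r0 i0] := H10_prim Vu.
rewrite eigfunE// /Hip /H1ip /= !L2ip_real L2ip_imag.
rewrite /mode_re /mode_im /pairdu.
rewrite -(segint_H1_eigfun n0 gr r0 ur) -(segint_H1_eigfun n0 gi i0 ui).
by [].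
Qed.

Lemma segint_id_eigu n (c : R) : n != 0 ->
  segint 0 1 (fun x => (x * c) * (sin (wavenumber R n * x) / dispersion R n)) =
  coupling n * c.
Proof.
move=> n0; rewrite /coupling -integral_id_sinM ?wavenumber_neq0//; last exact: sin_wavenumber.
rewrite mulrAC -mulrA mulrC -RintegralZl//.
  by apply: eq_Rintegral => x _; field; exact: dispersion_neq0.
apply/integrable_continuous/within_continuousM => //.
by apply: continuous_subspaceT => x; exact: cvg_id.
Qed.

(** The resolvents enter only through their weak identities, tested with the first component of
    [U_n], so no formula for them is used. The term in [h] disappears because the cosine has mean
    zero; the control acts through its derivative [k] alone. *)
Lemma mode_generator n (W : Hel R) (Psi Psi' Phi Phi' : R -> R[i]) (h k : R[i]) :
  n != 0 -> inH W ->
  resolvent (fun chi chi' => - L2ip (Hv W) chi') Psi Psi' ->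
  resolvent (fun chi chi' => L2ip (fun x => x%:C%C * k) chi) Phi Phi' ->
  - Hip (mkHel (fun x => - Psi x) (fun x => - Psi' x) (fun x => - Hdu W x)) (eigfun R n) +
    Hip (mkHel (fun x => - Phi x) (fun x => - Phi' x) (fun=> h)) (eigfun R n) =
  Complex (frequency R n * mode_im n W - coupling n * complex.Re k)
          (- (frequency R n * mode_re n W) - coupling n * complex.Im k).
Proof.
move=> n0 WH [_ PsiE] [_ PhiE]; have [UH _] := inH_eigfun R n.
have f0 := frequency_neq0 n0.
have [zr zi] := L2_integrable WH.2.
have e1 := PsiE _ _ UH; have e2 := PhiE _ _ UH.
rewrite /Hip /H1ip /= !L2ipN -!opprD.
move: e1 e2; rewrite /H1ip => -> ->.
rewrite eigfunE//= !L2ip_real !L2ip_imag.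
have cos0 (c : R) : segint 0 1 (fun x => c * cos (wavenumber R n * x)) = 0.
  rewrite segintZ_continuous; last exact: continuous_cosM.
  by rewrite integral_cosM ?mulr0 ?wavenumber_neq0//; exact: sin_wavenumber.
rewrite !cos0 oppr0.
have zc r : integrable_on 0 1 r ->
    segint 0 1 (fun x => r x * (wavenumber R n * cos (wavenumber R n * x) / dispersion R n)) =
    frequency R n * segint 0 1 (fun x => r x * cos (wavenumber R n * x)).
  move=> ri; rewrite -RintegralZl//; last exact: integrableM_continuous.
  by apply: eq_Rintegral => x _; rewrite /frequency; field; exact: dispersion_neq0.
rewrite (zc _ zr) (zc _ zi).
have xr : segint 0 1 (fun x => complex.Re (x%:C%C * k) * (sin (wavenumber R n * x) / dispersion R n)) =
    coupling n * complex.Re k.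
  by rewrite -segint_id_eigu//; apply: eq_Rintegral => x _; rewrite ReM /= mul0r subr0.
have xi : segint 0 1 (fun x => complex.Im (x%:C%C * k) * (sin (wavenumber R n * x) / dispersion R n)) =
    coupling n * complex.Im k.
  by rewrite -segint_id_eigu//; apply: eq_Rintegral => x _; rewrite ImM /= mul0r addr0.
rewrite xr xi /mode_re /mode_im /pairdu /pairv.
by congr Complex => /=; field.
Qed.

(** The first component of [U_0] is zero, which removes both resolvents, and the derivative of an
    H^1_0 function has mean zero. Only the control itself is left. *)
Lemma mode0_generator (W : Hel R) (Psi Psi' Phi Phi' : R -> R[i]) (h : R[i]) :
  inH W ->
  - Hip (mkHel (fun x => - Psi x) (fun x => - Psi' x) (fun x => - Hdu W x)) (eigfun R 0) +
    Hip (mkHel (fun x => - Phi x) (fun x => - Phi' x) (fun=> h)) (eigfun R 0) = h.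
Proof.
move=> [/H10_prim[_ _ r0 i0] _].
have one : (fun=> 1 : R[i]) = (fun x : R => (1 : R)%:C%C) by [].
rewrite /eigfun eqxx /Hip /H1ip /= !L2ip0r !add0r one !L2ipN opprK !L2ip_real.
have m1 (r : R -> R) : segint 0 1 (fun x => r x * 1) = segint 0 1 r.
  by apply: eq_Rintegral => x _; rewrite mulr1.
rewrite !m1 r0 i0 !Rintegral_cst//= lebesgue_measure_itv/= lte01 oppr0 addr0 !mulr1.
by case: h => a b; rewrite /= -[LHS]/(Complex (0 + a) (0 + b)) !add0r.
Qed.

End Modes.

(** * The controlled solution *)

Lemma coupling_neq0 (R : realType) (n : int) : n != 0 -> coupling R n != 0.
Proof.
move=> n0; rewrite /coupling mulf_neq0//.
  rewrite oppr_eq0 mulf_neq0 ?invr_eq0 ?wavenumber_eq0//.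
  by apply: cos_neq0; exact: sin_wavenumber.
by rewrite invr_eq0 gt_eqF// dispersion_gt0.
Qed.

(** With a = n pi and d = sqrt (1 + a^2), 1 - omega_n = (d - a) / d and (d - a) (d + a) = 1, so the
    gap is positive and below 1/a. Positivity is essential: the zeros must differ from their limit
    point 1. *)
Lemma frequency_near1 (R : realType) (N : nat) (e : R) : 0 < e ->
  exists2 n : nat, (N < n)%N & 0 < `|frequency R n%:Z - 1| < e.
Proof.
move=> e0; pose n := (maxn N (Num.Def.archi_bound e^-1)).+1.
exists n; first by rewrite ltnS leq_maxl.
pose a : R := wavenumber R n; pose d : R := dispersion R n.
have d0 : 0 < d := dispersion_gt0 R n.
have d2 : d ^+ 2 = 1 + a ^+ 2 := dispersion_sqr R n.
have ne : e^-1 < n%:R.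
  apply: (lt_trans (archi_boundP _)); first by rewrite invr_ge0 ltW.
  by rewrite ltr_nat ltnS leq_maxr.
have na : n%:R <= a.
  by rewrite /a /wavenumber ler_peMr// (le_trans _ (pi_ge2 R))// ler1n.
have a0 : 0 < a by apply: lt_le_trans na; rewrite (lt_trans _ ne)// invr_gt0.
have ad : a < d by rewrite -(ltr_pXn2r (n := 2)) ?nnegrE ?ltW// d2 ltrDr.
have E : (d - a) * (d + a) = 1 by rewrite -subr_sqr d2 addrK.
have d1 : 1 <= d by rewrite -[1]sqrtr1 ler_sqrt ?lerDl ?addr_ge0 ?sqr_ge0.
have f1 : frequency R n - 1 = - ((d - a) / d).
  by rewrite /frequency -/a -/d; field; rewrite gt_eqF.
rewrite f1 normrN gtr0_norm ?divr_gt0 ?subr_gt0//= ?divr_gt0 ?subr_gt0//.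
rewrite ltr_pdivrMr//; apply: (@lt_le_trans _ _ e); last by rewrite ler_peMr// ltW.
have ea : 1 < e * a.
  by rewrite mulrC -ltr_pdivrMr// div1r (lt_le_trans ne).
have da0 : 0 < d + a by rewrite addr_gt0.
rewrite -(ltr_pM2r da0) E (lt_trans ea)// ltr_pM2l// ltrDr.
by [].
Qed.

Lemma ae_imply (R : realType) (P Q : R -> Prop) : (forall x, P x -> Q x) ->
  {ae @lebesgue_measure R, forall x, P x} -> {ae @lebesgue_measure R, forall x, Q x}.
Proof.
move=> PQ [N [mN N0 PN]]; exists N; split=> // x nQ.
by apply: PN => /= /PQ.
Qed.

Lemma segint_ae_eq0 (R : realType) (f r : R -> R) : integrable_on 0 1 f -> continuous r ->
  {ae @lebesgue_measure R, forall x, `[0, 1]%classic x -> f x = 0} ->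
  segint 0 1 (fun x => f x * r x) = 0.
Proof.
move=> fi rc f0.
rewrite /Rintegral (@ae_eq_integral _ _ _ _ _ (cst 0%E))//.
- by rewrite integral0.
- have := integrableM_continuous fi (continuous_subspaceT rc).
  exact: measurable_int.
- apply: ae_imply f0.
  by move=> x f0 x01; rewrite /= f0// mul0r.
Qed.

Section ControlledSolution.
Variables (R : realType) (T : R) (U0 : Hel R) (h k : R -> R[i]) (W : R -> Hel R).
Hypotheses (T0 : 0 < T) (hk : is_prim 0 T h k) (h0 : h 0 = 0)
  (sol : is_solution T U0 h k W)
  (uT : forall x, 0 <= x <= 1 -> Hu (W T) x + x%:C%C * h T = 0)
  (vT : {ae (@lebesgue_measure R), forall x, `[0, 1]%classic x -> Hv (W T) x = 0}).

Let TT : 0 <= T <= T. Proof. by rewrite lexx ltW. Qed.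
Let WH : forall t, 0 <= t <= T -> inH (W t). Proof. by case: sol. Qed.

(** [W T] has its first component in H^1_0, so at x = 1 the terminal condition contains nothing but
    [h T]. *)
Let hT : h T = 0.
Proof.
have [_ [_ u1]] := (WH TT).1.
by have := uT (x := 1); rewrite u1 add0r mul1r => -> //; rewrite ler01 lexx.
Qed.

Let uT0 x : 0 <= x <= 1 -> Hu (W T) x = 0.
Proof. by move=> /uT; rewrite hT mulr0 addr0. Qed.

Let H1 t := segint 0 t (fun x => complex.Re (k x)).
Let H2 t := segint 0 t (fun x => complex.Im (k x)).

Let hE t : 0 <= t <= T -> h t = Complex (H1 t) (H2 t).
Proof. by case: hk => _ hp /hp ->; rewrite h0 add0r. Qed.

Let W0E : mkHel (fun x => Hu U0 x - x%:C%C * h 0) (fun x => Hdu U0 x - h 0) (Hv U0) = U0.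
Proof.
case: U0 => u du v; rewrite /= h0; congr mkHel; apply/funext => x.
  by rewrite mulr0 subr0.
by rewrite subr0.
Qed.

Let pairv_T (part : R[i] -> R) n :
  (forall f, L2 0 1 f -> integrable_on 0 1 (fun x => part (f x))) -> part 0 = 0 ->
  pairv part n (W T) = 0.
Proof.
move=> parti part0; apply: segint_ae_eq0.
- by apply: parti; exact: (WH TT).2.
- exact: continuous_cosM.
- apply: ae_imply vT.
  by move=> x v0 x01; rewrite v0.
Qed.

(** The terminal condition bears on [w], not on its weak derivative [g]; integration by parts
    transfers it to the pairing of [g] with the cosine. *)
Let pairdu_T (g w : R -> R) n : integrable_on 0 1 g -> segint 0 1 g = 0 ->
  (forall x, 0 <= x <= 1 -> w x = segint 0 x g) -> (forall x, 0 <= x <= 1 -> w x = 0) ->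
  segint 0 1 (fun x => g x * cos (wavenumber R n * x)) = 0.
Proof.
move=> gi g0 wE w0; rewrite -integral_primitive_sin//.
have -> : segint 0 1 (fun x => sin (wavenumber R n * x) * segint 0 x g) = segint 0 1 (fun=> 0).
  apply: eq_Rintegral => x; rewrite mem_setE in_itv/= => x01.
  by rewrite -wE// w0// mulr0.
by rewrite segint0 mulr0.
Qed.

Let mode_T n : mode_re n (W T) = 0 /\ mode_im n (W T) = 0.
Proof.
have [gr gi] := L2_integrable (WH TT).1.1.1.
have [ur ui r0 i0] := H10_prim (WH TT).1.
rewrite /mode_re /mode_im !pairv_T//; do ?[by move=> f /L2_integrable[]].
rewrite /pairdu (pairdu_T _ gr r0 ur) ?(pairdu_T _ gi i0 ui) ?mul0r ?addr0 ?subr0//.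
  by move=> x x01; rewrite uT0.
by move=> x x01; rewrite uT0.
Qed.

(* [osc T H2 H1 z] and [osc T (- H1) H2 z] are the imaginary part and the opposite
   of the real part of \int_0^T e^(i z s) h s ds. *)
Lemma solution_mode n : n != 0 -> Hip U0 (eigfun R n) =
  Complex (frequency R n * coupling R n * osc T H2 H1 (frequency R n))
          (frequency R n * coupling R n * osc T (fun s => - H1 s) H2 (frequency R n)).
Proof.
move=> n0; case: sol => _ [Wc [Psi [Psi' [Phi [Phi' [PsiP [PhiP WE]]]]]]].
have [kr ki] := L2_integrable hk.1.
have cW P part := @Hcont_pairing R T W P part (fun x => cos (wavenumber R n * x)).
have cpair P : (forall V, segint 0 1 (sqmod (P V)) <= Hnorm2 V) ->
    (forall V U x, P (Hsub V U) x = P V x - P U x) ->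
    (forall t, 0 <= t <= T -> L2 0 1 (P (W t))) ->
    {within `[0, T]%classic, continuous (fun t => segint 0 1 (fun x => complex.Re (P (W t) x) * cos (wavenumber R n * x)))} /\
    {within `[0, T]%classic, continuous (fun t => segint 0 1 (fun x => complex.Im (P (W t) x) * cos (wavenumber R n * x)))}.
  move=> PN PB PL.
  have c1 (x : R) : `|cos (wavenumber R n * x)| <= 1 by rewrite ler_norml cos_geN1 cos_le1.
  split; apply: cW => //; try exact: continuous_cosM; try exact: ReB; try exact: ImB.
  - by move=> z; rewrite lerDl sqr_ge0.
  - by move=> f /L2_integrable[].
  - by move=> z; rewrite lerDr sqr_ge0.
  - by move=> f /L2_integrable[].
have [cdr cdi] := cpair (@Hdu R) (fun V => (Hnorm2_ge V).1) (fun _ _ _ => erefl)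
  (fun t tT => (WH tT).1.1.1).
have [cvr cvi] := cpair (@Hv R) (fun V => (Hnorm2_ge V).2) (fun _ _ _ => erefl)
  (fun t tT => (WH tT).2).
have cA1 : {within `[0, T]%classic, continuous (fun t => mode_re n (W t))}.
  apply: within_continuousD => //.
  by apply: within_continuousM => //; apply: continuous_subspaceT; exact: cst_continuous.
have cA2 : {within `[0, T]%classic, continuous (fun t => mode_im n (W t))}.
  apply: within_continuousD; last exact: within_continuousN.
  by apply: within_continuousM => //; apply: continuous_subspaceT; exact: cst_continuous.
(* The weak equation tested with [U_n] is, componentwise, a forced rotation of speed omega_n and
   coupling beta_n. *)
have AE t : 0 <= t <= T -> Complex (mode_re n (W t)) (mode_im n (W t)) =
    Hip U0 (eigfun R n) + Complex
      (segint 0 t (fun s => frequency R n * mode_im n (W s) - coupling R n * complex.Re (k s)))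
      (segint 0 t (fun s => - (frequency R n * mode_re n (W s)) - coupling R n * complex.Im (k s))).
  move=> tT; rewrite -Hip_eigfunr//; last exact: WH.
  rewrite (WE _ (inH_eigfun R n) t tT) W0E; congr (_ + _).
  have st s : s \in `[0, t]%classic -> 0 <= s <= T.
    rewrite mem_setE in_itv/= => /andP[-> st]; apply: (le_trans st).
    by case/andP: tT.
  rewrite cintE; congr Complex; apply: eq_Rintegral => s /st sT.
    by rewrite (mode_generator (h s) n0 (WH sT) (PsiP s sT) (PhiP s sT)).
  by rewrite (mode_generator (h s) n0 (WH sT) (PsiP s sT) (PhiP s sT)).
have [m1 m2] := mode_T n.
have HT := hE TT; rewrite hT in HT.
case: (Hip U0 (eigfun R n)) AE => a1 a2 AE.
have [-> ->] // := @forced_rotation_moments R T (frequency R n) (coupling R n) a1 a2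
  (fun t => mode_re n (W t)) (fun t => mode_im n (W t))
  (fun x => complex.Re (k x)) (fun x => complex.Im (k x)) T0 kr ki cA1 cA2
  (fun t tT => congr1 (@complex.Re R) (AE t tT)) (fun t tT => congr1 (@complex.Im R) (AE t tT))
  m1 m2 (congr1 (@complex.Re R) (esym HT)) (congr1 (@complex.Im R) (esym HT)).
Qed.

(** Testing the equation at time T with [U_0] gives (U^0, U_0) = - \int_0^T h. This is written
    through [osc] at frequency 0 so that the identity theorem applies to it. *)
Lemma solution_mode0 : Hip U0 (eigfun R 0) =
  Complex (osc T (fun s => - H1 s) H2 0) (- osc T H2 H1 0).
Proof.
case: sol => _ [_ [Psi [Psi' [Phi [Phi' [_ [_ WE]]]]]]].
have := WE _ (inH_eigfun R 0) T TT; rewrite W0E.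
have -> : Hip (W T) (eigfun R 0) = 0.
  have [vr vi] := L2_integrable (WH TT).2.
  have one : (fun=> 1 : R[i]) = (fun x : R => (1 : R)%:C%C) by [].
  rewrite /eigfun eqxx /Hip /H1ip /= !L2ip0r !add0r one L2ip_real.
  rewrite !segint_ae_eq0//; try exact: cst_continuous.
  - apply: ae_imply vT.
    by move=> x v0 x01; rewrite v0.
  - apply: ae_imply vT.
    by move=> x v0 x01; rewrite v0.
move=> /esym/eqP; rewrite addr_eq0 => /eqP ->.
have st s : s \in `[0, T]%classic -> 0 <= s <= T by rewrite mem_setE in_itv.
rewrite /osc -!RintegralN cintE.
rewrite -[LHS]/(Complex (- _) (- _)) -!RintegralN.
congr Complex; apply: eq_Rintegral => s /st sT;
  rewrite (mode0_generator _ _ _ _ _ (WH sT)) hE//= mul0r cos0 sin0 !mul1r mul0r addr0//.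
Qed.

End ControlledSolution.

Unset Implicit Arguments.

(** States are carried by representatives: being nonzero is expressed by the H product, [v] vanishes
    almost everywhere at time T, and [u], which is continuous in x, vanishes pointwise. *)
Theorem theorem1p3 (R : realType) (T : R) (s : seq int) (c : int -> R[i]) :
  0 < T ->
  Hip (eigcomb s c) (eigcomb s c) != 0 ->
  ~ exists (h k : R -> R[i]) (W : R -> Hel R),
      is_prim 0 T h k /\ h 0 = 0 /\
      is_solution T (eigcomb s c) h k W /\
      (forall x, 0 <= x <= 1 -> Hu (W T) x + x%:C%C * h T = 0) /\
      {ae (@lebesgue_measure R), forall x, `[0, 1]%classic x -> Hv (W T) x = 0}.
Proof.
move=> T0 U0n [h [k [W [hk [h0 [sol [uT vT]]]]]]].
pose H1 t := segint 0 t (fun x => complex.Re (k x)).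
pose H2 t := segint 0 t (fun x => complex.Im (k x)).
have modeE n (n0 : n != 0) := solution_mode T0 hk h0 sol uT vT n0.
have mode0 := solution_mode0 T0 hk h0 sol vT.
have [kr ki] := L2_integrable hk.1.
have cI f : integrable_on 0 T f -> integrable_on 0 T (fun t => segint 0 t f).
  move=> fi; apply: integrable_continuous.
  exact: parameterized_integral_continuous (ltW T0) fi.
have H1i : integrable_on 0 T H1 := cI _ kr.
have H2i : integrable_on 0 T H2 := cI _ ki.
have [N sN] : exists N : nat, forall m, m \in s -> (`|m| <= N)%N.
  exists (\max_(m <- s) `|m|)%N => m ms.
  by rewrite (big_rem m ms)/= leq_maxl.
have high (n : nat) : (N < n)%N -> Hip (eigcomb s c) (eigfun R n) = 0.
  move=> Nn; rewrite Hip_eigcombl; last exact: ccontinuous_eigfun.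
  rewrite big1_seq// => m /andP[_ ms]; rewrite Hip_eigfun_ortho ?mulr0//.
    by rewrite -lt0n (leq_ltn_trans _ Nn).
  apply/eqP => mn; have := sN m ms; rewrite leqNgt => /negP; apply.
  suff -> : `|m|%N = n by [].
  have /eqP := congr1 absz mn; rewrite !abszX /= eqn_exp2r// => /eqP.
  by [].
(* Division by omega_n beta_n, which is nonzero, turns the vanishing of a high mode into a common
   zero of both real functions at omega_n. *)
have zeros (e : R) : 0 < e -> exists2 z, 0 < `|z - 1| < e &
    osc T H2 H1 z = 0 /\ osc T (fun s => - H1 s) H2 z = 0.
  move=> e0; have [n Nn nP] := frequency_near1 N e0.
  exists (frequency R n) => //.
  have n0 : (n : int) != 0 by rewrite -lt0n (leq_ltn_trans _ Nn).
  have := modeE _ n0; rewrite high// => -[/esym/eqP + /esym/eqP].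
  have fc : frequency R n * coupling R n != 0.
    by rewrite mulf_neq0 ?frequency_neq0 ?coupling_neq0.
  rewrite mulf_eq0 (negbTE fc)/= => /eqP ?.
  by rewrite mulf_eq0 (negbTE fc)/= => /eqP.
have o1 : forall z, osc T H2 H1 z = 0.
  by apply: (osc_eq0 T0 (x0 := 1)) => // e /zeros[z zP [? ?]]; exists z.
have o2 : forall z, osc T (fun s => - H1 s) H2 z = 0.
  apply: (osc_eq0 T0 (x0 := 1)) => //; first exact: integrable_onN.
  by move=> e /zeros[z zP [? ?]]; exists z.
have orth n : Hip (eigcomb s c) (eigfun R n) = 0.
  have [->|n0] := eqVneq n 0; first by rewrite mode0 o1 o2 oppr0.
  by rewrite modeE// o1 o2 mulr0.
move/eqP: U0n; apply.
rewrite Hip_eigcombl; last exact: Hccontinuous_eigcomb.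
by rewrite big1// => n _; rewrite HipC orth rmorph0 mulr0.
Qed.
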